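(* Let $G\subset\mathrm{Conf}(\mathbb{E}^3)$ be a connected Lie subgroup which acts on $\mathbb{E}^3$ with cohomogeneity zero. Then, up to conjugacy in $\mathrm{Conf}(\mathbb{E}^3)$, $G$ admits the same orbits in $\mathbb{E}^3$ as those induced by one of the following groups: $$\mathbb{R}^3,\quad \mathbb{R}_+^*\ltimes \mathscr{P},\quad (\mathbb{R}_+^*\times SO(2))\ltimes \mathscr{L},\quad \mathbb{R}_+^*\times SO(3).$$
   Context: Cohomogeneity: an action of a Lie group $G$ on an $n$-manifold $M$ is of cohomogeneity $k$ if the maximum dimension among the $G$-orbits in $M$ is $n-k$. Lie subgroups are not assumed to be closed. ''Up to conjugacy $G$ admits the same orbits as $H$'' means that some conjugate of $G$ has exactly the same orbits as $H$. $\mathbb{E}^3$ is $3$-dimensional Euclidean space with a chosen origin. $\mathrm{Conf}(\mathbb{E}^3)$ is identified with $(\mathbb{R}^*\times O(3))\ltimes\mathbb{R}^3$, where $\mathbb{R}^*=\mathbb{R}\setminus\{0\}$, with product $(\alpha,A,v)(\beta,B,w)=(\alpha\beta,AB,\alpha A(w)+v)$, the element $(\alpha,A,v)$ acting by $x\mapsto\alpha A(x)+v$. Let $\{e_1,e_2,e_3\}$ be the standard basis of $\mathbb{R}^3$ and $R_t=\begin{bmatrix}\cos t&\sin t&0\\-\sin t&\cos t&0\\0&0&1\end{bmatrix}$. Inside this group: $\mathbb{R}^3$, $\mathscr{P}=\mathbb{R}e_1\oplus\mathbb{R}e_2$ and $\mathscr{L}=\mathbb{R}e_3$ are groups of translations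 $(1,\mathrm{Id},v)$; $\mathbb{R}_+^*=\{(\alpha,\mathrm{Id},0):\alpha>0\}$; $SO(3)=\{(1,A,0):A\in SO(3)\}$; $SO(2)=\{(1,R_t,0):t\in\mathbb{R}\}$. Products and semi-direct products are the subgroups generated by the indicated factors. *)

(* Defs.v *)
From HB Require Import structures.
From mathcomp Require Import all_boot all_order all_algebra.
From mathcomp Require Import all_classical all_reals all_analysis.

Set Implicit Arguments.
Unset Strict Implicit.
Unset Printing Implicit Defensive.

Import Order.TTheory GRing.Theory Num.Theory.
Import numFieldNormedType.Exports.

Local Open Scope classical_set_scope.
Local Open Scope ring_scope.

(** * Smooth maps and immersed submanifolds of a normed space *)

(** [f] is of class C^k on the set [U], which is meant to be open. *)
Fixpoint Ck_on (R : realType) (V W : normedModType R) (k : nat)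
    (U : set V) (f : V -> W) : Prop :=
  match k with
  | 0 => forall x, U x -> {for x, continuous f}
  | k'.+1 => (forall x, U x -> differentiable f x) /\
             (forall v, Ck_on k' U ('D_v f))
  end.

Definition smooth_on (R : realType) (V W : normedModType R)
    (U : set V) (f : V -> W) : Prop := forall k, Ck_on k U f.

(** A chart is given by its inverse, a parametrization of a piece of a subset
    of [V]; only the values of [chart_map] on [chart_dom] are meaningful. *)
Record chart (R : realType) (V : normedModType R) (d : nat) := Chart {
  chart_dom : set 'rV[R]_d;
  chart_map :> 'rV[R]_d -> V
}.

Definition chart_im (R : realType) (V : normedModType R) (d : nat)
    (c : chart V d) : set V := c @` chart_dom c.

(** The map [f], defined on the open set [U], takes its values in the manifold
    with atlas [A] and is smooth for that manifold structure.  The openness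
    requirement is continuity for the manifold topology, which may be finer
    than the topology induced by [V]. *)
Definition smooth_into (R : realType) (V E : normedModType R) (d : nat)
    (A : set (chart V d)) (U : set E) (f : E -> V) : Prop :=
  (forall u, U u -> exists2 c, A c & chart_im c (f u)) /\
  forall c, A c ->
    let W := U `&` f @^-1` chart_im c in
    open W /\
    exists theta : E -> 'rV[R]_d, smooth_on W theta /\
      forall u, W u -> chart_dom c (theta u) /\ c (theta u) = f u.

(** [A] is a smooth atlas making [S] a [d]-dimensional manifold such that the
    inclusion of [S] in [V] is an immersion (not necessarily an embedding).
    Such a manifold is Hausdorff since the inclusion is continuous. *)
Definition immersed_submanifold (R : realType) (V : normedModType R) (d : nat)
    (S : set V) (A : set (chart V d)) : Prop :=
  [/\ forall c, A c ->
        [/\ open (chart_dom c),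
            smooth_on (chart_dom c) c,
            {in chart_dom c &, injective c} &
            forall u, chart_dom c u -> injective ('d c u)],
      S = \bigcup_(c in A) chart_im c &
      forall c, A c -> smooth_into A (chart_dom c) c].

(** Open sets of the manifold topology. *)
Definition manifold_open (R : realType) (V : normedModType R) (d : nat)
    (A : set (chart V d)) (O : set V) : Prop :=
  forall c, A c -> open (chart_dom c `&` c @^-1` O).

Definition manifold_connected (R : realType) (V : normedModType R) (d : nat)
    (S : set V) (A : set (chart V d)) : Prop :=
  forall O1 O2 : set V, manifold_open A O1 -> manifold_open A O2 ->
    O1 `|` O2 = S -> O1 `&` O2 = set0 -> O1 = set0 \/ O2 = set0.

(** * The conformal group of Euclidean 3-space *)

(** Triples (alpha, A, v).  The group R^* x O(3) x R^3 is a closed embedded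
    submanifold of this vector space, so that a map into the group is smooth,
    or an immersion, exactly when it is so as a map into the vector space. *)
Definition conf_space (R : realType) : normedModType R :=
  (R^o * 'M[R]_3 * 'cV[R]_3)%type.

Definition cmk (R : realType) (a : R) (M : 'M[R]_3) (v : 'cV[R]_3) :
  conf_space R := (a, M, v).
Definition cscale (R : realType) (g : conf_space R) : R := g.1.1.
Definition clin (R : realType) (g : conf_space R) : 'M[R]_3 := g.1.2.
Definition ctrans (R : realType) (g : conf_space R) : 'cV[R]_3 := g.2.

Definition Conf (R : realType) : set (conf_space R) :=
  [set g | cscale g != 0 /\ clin g *m (clin g)^T = 1%:M].

Definition cone (R : realType) : conf_space R := cmk 1 1%:M 0.

Definition cmul (R : realType) (g h : conf_space R) : conf_space R :=
  cmk (cscale g * cscale h) (clin g *m clin h)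
      (cscale g *: (clin g *m ctrans h) + ctrans g).

(** The inverse on [Conf R], where the transpose of [clin g] is its inverse. *)
Definition cinv (R : realType) (g : conf_space R) : conf_space R :=
  cmk (cscale g)^-1 (clin g)^T
      (- ((cscale g)^-1 *: ((clin g)^T *m ctrans g))).

Definition cact (R : realType) (g : conf_space R) (x : 'cV[R]_3) : 'cV[R]_3 :=
  cscale g *: (clin g *m x) + ctrans g.

Definition conf_subgroup (R : realType) (G : set (conf_space R)) : Prop :=
  [/\ G `<=` @Conf R, G (cone R),
      forall g h, G g -> G h -> G (cmul g h) &
      forall g, G g -> G (cinv g)].

Definition conf_conj (R : realType) (c : conf_space R)
    (G : set (conf_space R)) : set (conf_space R) :=
  [set cmul (cmul c g) (cinv c) | g in G].

Definition orbit_of (R : realType) (G : set (conf_space R)) (x : 'cV[R]_3) :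
  set 'cV[R]_3 := [set cact g x | g in G].

Definition orbits (R : realType) (G : set (conf_space R)) :
  set (set 'cV[R]_3) := range (orbit_of G).

Definition same_orbits_up_to_conj (R : realType)
    (G H : set (conf_space R)) : Prop :=
  exists2 c, Conf c & orbits (conf_conj c G) = orbits H.

(** * Lie subgroups and cohomogeneity *)

(** [A] makes the subgroup [G] a Lie group smoothly and injectively immersed
    in [Conf R].  Connected Lie groups are automatically second countable. *)
Definition lie_subgroup (R : realType) (d : nat) (G : set (conf_space R))
    (A : set (chart (conf_space R) d)) : Prop :=
  [/\ conf_subgroup G,
      immersed_submanifold G A,
      forall c1 c2, A c1 -> A c2 ->
        smooth_into A (chart_dom c1 `*` chart_dom c2)
          (fun u : 'rV[R]_d * 'rV[R]_d => cmul (c1 u.1) (c2 u.2)) &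
      forall c, A c -> smooth_into A (chart_dom c) (fun u => cinv (c u))].

Definition connected_lie_subgroup (R : realType) (d : nat)
    (G : set (conf_space R)) (A : set (chart (conf_space R) d)) : Prop :=
  lie_subgroup G A /\ manifold_connected G A.

(** The orbit of [x] has dimension [k]: it is an immersed submanifold of
    dimension [k] for the structure of the quotient of [G] by the stabilizer
    of [x], that is, the one for which the orbit map is a smooth submersion.
    The last clause says that the differential of the orbit map is onto the
    tangent space of the orbit. *)
Definition orbit_has_dim (R : realType) (d : nat) (G : set (conf_space R))
    (A : set (chart (conf_space R) d)) (x : 'cV[R]_3) (k : nat) : Prop :=
  exists B : set (chart 'cV[R]_3 k),
    [/\ immersed_submanifold (orbit_of G x) B,
        forall c, A c -> smooth_into B (chart_dom c) (fun u => cact (c u) x) &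
        forall c b u w, A c -> B b -> chart_dom c u -> chart_dom b w ->
          b w = cact (c u) x ->
          range ('d (fun u' => cact (c u') x) u) = range ('d b w)].

Definition has_cohomogeneity (R : realType) (d : nat) (G : set (conf_space R))
    (A : set (chart (conf_space R) d)) (k : nat) : Prop :=
  exists m, [/\ (m + k = 3)%N,
                exists x, orbit_has_dim G A x m &
                forall x m', orbit_has_dim G A x m' -> (m' <= m)%N].

(** * The model groups *)

Definition e_ (R : realType) (i : 'I_3) : 'cV[R]_3 := delta_mx i 0.

Definition Rot (R : realType) (t : R) : 'M[R]_3 :=
  \matrix_(i < 3, j < 3)
    nth 0 (nth [::] [:: [:: cos t; sin t; 0];
                        [:: - sin t; cos t; 0];
                        [:: 0; 0; 1]] i) j.

Definition trans_grp (R : realType) : set (conf_space R) :=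
  [set cmk 1 1%:M v | v in setT].

Definition P_grp (R : realType) : set (conf_space R) :=
  [set g | exists a b : R,
     g = cmk 1 1%:M (a *: e_ R (inord 0) + b *: e_ R (inord 1))].

Definition L_grp (R : realType) : set (conf_space R) :=
  [set g | exists a : R, g = cmk 1 1%:M (a *: e_ R (inord 2))].

Definition Rpos_grp (R : realType) : set (conf_space R) :=
  [set g | exists2 a : R, 0 < a & g = cmk a 1%:M 0].

Definition SO3_grp (R : realType) : set (conf_space R) :=
  [set g | exists M : 'M[R]_3,
     [/\ M *m M^T = 1%:M, \det M = 1 & g = cmk 1 M 0]].

Definition SO2_grp (R : realType) : set (conf_space R) :=
  [set g | exists t : R, g = cmk 1 (Rot t) 0].

Definition conf_gen (R : realType) (X : set (conf_space R)) :
  set (conf_space R) := smallest (@conf_subgroup R) X.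

Arguments trans_grp R : clear implicits.
Arguments P_grp R : clear implicits.
Arguments L_grp R : clear implicits.
Arguments Rpos_grp R : clear implicits.
Arguments SO2_grp R : clear implicits.
Arguments SO3_grp R : clear implicits.

(* Main.v *)
Require Import Defs.
From HB Require Import structures.
From mathcomp Require Import all_boot all_order all_algebra.
From mathcomp Require Import all_classical all_reals all_analysis.
From mathcomp Require Import ring lra.
Require Import Defs.

Set Implicit Arguments.
Unset Strict Implicit.
Unset Printing Implicit Defensive.

Import Order.TTheory GRing.Theory Num.Theory.
Import numFieldNormedType.Exports.

Local Open Scope classical_set_scope.
Local Open Scope ring_scope.

(** The tangent space at the identity of [G] is a space [T] of infinitesimal
    motions, stable under the adjoint action of [G] ([tangent_Ad]); an
    infinitesimal motion has a velocity at each point ([inf_act]).  Where the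
    velocities fill the whole space the orbit is open ([full_open]), by local
    surjectivity of maps with a surjective differential ([local_surjection]),
    and cohomogeneity zero means that there is such a point [x]
    ([open_orbit_point]).  As [G] is connected, its scale factors are positive
    ([lie_sign]).

    If all scale factors are 1, the orbit of [x] contains balls of a fixed
    radius around all its points, so it is the whole space
    ([isometric_transitive]).

    Otherwise some element of [G] is a contraction with a fixed point [p], which
    plays the role of the origin.  Its powers expand the translation parts under
    the adjoint action and keep the linear parts bounded, so that, [T] being
    closed, the translation part at [p] of each element of [T] belongs to [T]
    ([translation_part]).  The space [V] of translations in [T] is stable under
    the linear parts of [G], hence [p + V] is stable under [G], and it is a
    single orbit because velocities fill it ([reach_flat]).  Velocities modulo
    [V] depend only on the position modulo [p + V], and linearly.  Therefore the
    points of the form [p + r (g x - p) + v], with [g] in [G], [v] in [V] and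
    [r] not 0, have open orbits; since [G] acts by similarities these points form
    an open cone that is also closed outside [p + V], so they are all the points
    outside [p + V] ([full_outside]).  Two points that a segment joins outside
    [p + V] are thus in the same orbit ([reach_segment]).

    It remains to let the dimension of [V] vary.  If it is 3 the group is
    transitive; if it is 2 the orbits are the plane [p + V] and its two sides,
    which a connected group cannot exchange; if it is 1 or 0 they are [p + V] and
    its complement, which is connected ([reach_outside]).  An isometry taking [p]
    to 0 and [V] to a coordinate subspace identifies these with the orbits of
    the four model groups ([orbits_halfspace], [orbits_axis],
    [orbits_origin]). *)

(** * Derivatives of the product and of the action *)

Section Coordinates.
Variable R : realType.
Implicit Types (g h t s : conf_space R) (x y : 'cV[R]_3).

Lemma conf_eqP g h : cscale g = cscale h ->
  (forall i j, clin g i j = clin h i j) ->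
  (forall i, ctrans g i 0 = ctrans h i 0) -> g = h.
Proof.
move: g h => [[a M] v] [[b N] w]; rewrite /cscale /clin /ctrans /= => -> HM Hv.
have -> : M = N by apply/matrixP.
by have -> : v = w by apply/matrixP => i j; rewrite ord1.
Qed.

Lemma cscale_linear : linear (@cscale R : conf_space R -> R^o).
Proof. by move=> k [[a M] v] [[b N] w]. Qed.
Lemma clin_linear i j : linear (fun g => clin g i j : R^o).
Proof. by move=> k [[a M] v] [[b N] w]; rewrite /clin /= !mxE. Qed.
Lemma ctrans_linear i : linear (fun g => ctrans g i 0 : R^o).
Proof. by move=> k [[a M] v] [[b N] w]; rewrite /ctrans /= !mxE. Qed.

Lemma cscale_continuous : continuous (@cscale R : conf_space R -> R^o).
Proof.
move=> g; apply: (@continuous_comp _ _ _ fst fst); exact: cvg_fst.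
Qed.
Lemma clin_continuous i j : continuous (fun g => clin g i j : R^o).
Proof.
move=> g; apply: (@continuous_comp _ _ _ (fun g : conf_space R => g.1.2)
  (fun M : 'M[R]_3 => M i j)).
  by apply: (@continuous_comp _ _ _ fst snd); [exact: cvg_fst|exact: cvg_snd].
exact: coord_continuous.
Qed.
Lemma ctrans_continuous i : continuous (fun g => ctrans g i 0 : R^o).
Proof.
move=> g; apply: (@continuous_comp _ _ _ (fun g : conf_space R => g.2)
  (fun M : 'cV[R]_3 => M i 0)).
  exact: cvg_snd.
exact: coord_continuous.
Qed.
End Coordinates.

Section Deriv.
Variables (R : realType) (E : normedModType R).

Lemma differentiable_lin (F : normedModType R) (h : E -> F) (phi : F -> R^o) x :
  linear phi -> continuous phi -> differentiable h x ->
  differentiable (phi \o h) x.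
Proof.
move=> lphi cphi dh.
pose phiL : {linear F -> R^o} :=
  HB.pack phi (GRing.isLinear.Build R F R^o _ _ lphi).
have : differentiable phiL (h x) by apply: linear_differentiable; exact: cphi.
exact: differentiable_comp.
Qed.

Lemma is_derive_lin (F : normedModType R) (h : E -> F) (phi : F -> R^o) x v :
  linear phi -> continuous phi -> differentiable h x ->
  is_derive x v (phi \o h) (phi ('D_v h x)).
Proof.
move=> lphi cphi dh; have dc := differentiable_lin lphi cphi dh.
apply: DeriveDef; first exact: diff_derivable.
pose phiL : {linear F -> R^o} :=
  HB.pack phi (GRing.isLinear.Build R F R^o _ _ lphi).
rewrite deriveE// (@diff_comp _ _ _ _ h phiL)//; last first.
  by apply: linear_differentiable; exact: cphi.
by rewrite diff_lin// deriveE.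
Qed.

Implicit Types (h : E -> conf_space R) (g t s : conf_space R) (y : 'cV[R]_3).

Lemma is_derive_cscale h x v : differentiable h x ->
  is_derive x v (fun u => cscale (h u)) (cscale ('D_v h x)).
Proof. by move=> dh; exact: (is_derive_lin v (@cscale_linear R) (@cscale_continuous R) dh). Qed.

Lemma is_derive_clin h x v i j : differentiable h x ->
  is_derive x v (fun u => clin (h u) i j) (clin ('D_v h x) i j).
Proof. by move=> dh; exact: (is_derive_lin v (@clin_linear R i j) (@clin_continuous R i j) dh). Qed.

Lemma is_derive_ctrans h x v i : differentiable h x ->
  is_derive x v (fun u => ctrans (h u) i 0) (ctrans ('D_v h x) i 0).
Proof. by move=> dh; exact: (is_derive_lin v (@ctrans_linear R i) (@ctrans_continuous R i) dh). Qed.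

Lemma is_derive_mulR (f g : E -> R) x v a b : is_derive x v f a ->
  is_derive x v g b -> is_derive x v (fun u => f u * g u) (a * g x + f x * b).
Proof.
move=> df dg; have := is_deriveM df dg => /is_derive_eq; apply.
by rewrite addrC; congr (_ + _); exact: mulrC.
Qed.

Lemma is_derive_mulmx m n p (M : E -> 'M[R]_(m, n)) (N : E -> 'M[R]_(n, p))
    (M' : 'M[R]_(m, n)) (N' : 'M[R]_(n, p)) x v :
  (forall i j, is_derive x v (fun u => M u i j) (M' i j)) ->
  (forall i j, is_derive x v (fun u => N u i j) (N' i j)) ->
  forall i j,
    is_derive x v (fun u => (M u *m N u) i j) ((M' *m N x + M x *m N') i j).
Proof.
move=> dM dN i j.
have -> : (fun u => (M u *m N u) i j) = \sum_k (fun u => M u i k * N u k j).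
  by apply/funext => u; rewrite mxE fct_sumE.
have -> : (M' *m N x + M x *m N') i j =
    \sum_k (M' i k * N x k j + M x i k * N' k j).
  by rewrite !mxE big_split.
by apply: is_derive_sum => k; exact: is_derive_mulR.
Qed.

Lemma is_derive_clin_mul h x v m (y : 'M[R]_(3, m)) i k : differentiable h x ->
  is_derive x v (fun u => (clin (h u) *m y) i k) ((clin ('D_v h x) *m y) i k).
Proof.
move=> dh.
have dy a b : is_derive x v (fun=> y a b) ((0 : 'M[R]_(3, m)) a b).
  by rewrite mxE; exact: is_derive_cst.
have := is_derive_mulmx (fun i j => is_derive_clin v i j dh) dy i k.
by rewrite mulmx0 addr0.
Qed.

(** The differential at [g] of the action on the point [y]. *)
Definition dcact g t y : 'cV[R]_3 :=
  cscale t *: (clin g *m y) + cscale g *: (clin t *m y) + ctrans t.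

Lemma cactE g y i : cact g y i 0 = cscale g * (clin g *m y) i 0 + ctrans g i 0.
Proof. by rewrite /cact mxE [X in X + _]mxE. Qed.

Lemma dcactE g t y i : dcact g t y i 0 =
  cscale t * (clin g *m y) i 0 + cscale g * (clin t *m y) i 0 + ctrans t i 0.
Proof. by rewrite /dcact mxE; congr (_ + _); rewrite mxE; congr (_ + _); rewrite mxE. Qed.

Lemma is_derive_cact h x v y i : differentiable h x ->
  is_derive x v (fun u => cact (h u) y i 0) (dcact (h x) ('D_v h x) y i 0).
Proof.
move=> dh.
have -> : (fun u => cact (h u) y i 0) =
  (fun u => cscale (h u)) * (fun u => (clin (h u) *m y) i 0)
  + (fun u => ctrans (h u) i 0).
  by apply/funext => u; rewrite cactE.
have := is_derive_cscale v dh; have := is_derive_ctrans v i dh.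
have := is_derive_clin_mul v y i 0 dh.
move=> dl dt ds.
apply: is_derive_eq.
rewrite dcactE; congr (_ + _); rewrite addrC; congr (_ + _); exact: mulrC.
Qed.

(** The differential of the multiplication at [(g, h)], applied to [(t, s)]. *)
Definition dcmul g g' t s : conf_space R :=
  cmk (cscale t * cscale g' + cscale g * cscale s)
    (clin t *m clin g' + clin g *m clin s)
    (dcact g t (ctrans g') + cscale g *: (clin g *m ctrans s)).

Lemma derive_cmul h1 h2 x v : differentiable h1 x -> differentiable h2 x ->
  differentiable (fun u => cmul (h1 u) (h2 u)) x ->
  'D_v (fun u => cmul (h1 u) (h2 u)) x =
  dcmul (h1 x) (h2 x) ('D_v h1 x) ('D_v h2 x).
Proof.
move=> d1 d2 dm.
have ds1 := is_derive_cscale v d1; have ds2 := is_derive_cscale v d2.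
have dl1 := fun i j => is_derive_clin v i j d1.
have dl2 := fun i j => is_derive_clin v i j d2.
have dt1 := fun i => is_derive_ctrans v i d1.
have dt2 := fun i => is_derive_ctrans v i d2.
apply: conf_eqP => [|i j|i].
- have /@derive_val <- := is_derive_cscale v dm.
  by have /@derive_val := is_derive_mulR ds1 ds2.
- have /@derive_val <- := is_derive_clin v i j dm.
  by have /@derive_val := is_derive_mulmx dl1 dl2 i j.
- have /@derive_val <- := is_derive_ctrans v i dm.
  have dt2' k (j : 'I_1) :
    is_derive x v (fun u => ctrans (h2 u) k j) (ctrans ('D_v h2 x) k j).
    by rewrite (ord1 j); exact: dt2.
  have := is_deriveD
    (is_derive_mulR ds1 (is_derive_mulmx dl1 dt2' i 0)) (dt1 i).
  move=> /@derive_val.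
  have -> : (fun u => cscale (h1 u) * (clin (h1 u) *m ctrans (h2 u)) i 0) +
      (fun u => ctrans (h1 u) i 0) = (fun u => ctrans (cmul (h1 u) (h2 u)) i 0).
    by apply/funext => u; rewrite -[RHS]/(cact (h1 u) (ctrans (h2 u)) i 0) cactE.
  rewrite [X in _ + _ * X + _]mxE => ->.
  have -> : ctrans (dcmul (h1 x) (h2 x) ('D_v h1 x) ('D_v h2 x)) i 0 =
    dcact (h1 x) ('D_v h1 x) (ctrans (h2 x)) i 0 +
    cscale (h1 x) * (clin (h1 x) *m ctrans ('D_v h2 x)) i 0.
    by rewrite [ctrans _]/= mxE [X in _ + X]mxE.
  rewrite dcactE; ring.
Qed.
End Deriv.

(** * Maps that are smooth for a manifold structure *)

Section LocalDifferential.
Variables (R : realType) (E V : normedModType R).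

Lemma near_eq_diff (f g : E -> V) (x : E) :
  differentiable g x -> (\forall y \near x, f y = g y) ->
  differentiable f x /\ 'd f x = 'd g x :> (E -> V).
Proof.
move=> dg fg.
have fgx : f x = g x by apply: (nbhs_singleton fg).
have H : f \o shift x = cst (f x) + 'd g x +o_ 0 id.
  apply/eqaddoP => e e0.
  have /eqaddoP /(_ e e0) := diff_locally dg.
  have fg0 : \forall y \near (0 : E), f (y + x) = g (y + x).
    by move: fg; rewrite (near_shift (0 : E) x) subr0.
  move=> gx; near=> y.
  rewrite !fctE /= fgx.
  have -> : f (y + x) = g (y + x) by near: y.
  by near: y.
have dfg : 'd f x = 'd g x :> (E -> V).
  by apply: diff_unique H; exact: diff_continuous.
split=> //; apply/diff_locallyP; rewrite dfg; split=> //; exact: diff_continuous.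
Unshelve. all: by end_near. Qed.

Lemma smooth_on_diff (U : set E) (f : E -> V) x : smooth_on U f -> U x -> differentiable f x.
Proof. by move=> /(_ 1) [H _] /H. Qed.

Lemma smooth_on_derive_cont (U : set E) (f : E -> V) v x :
  smooth_on U f -> U x -> {for x, continuous ('D_v f)}.
Proof. by move=> /(_ 1) [_ H] /H. Qed.

End LocalDifferential.

Section Charts.
Variables (R : realType) (V : normedModType R) (d : nat).
Variables (S : set V) (A : set (chart V d)).
Hypothesis SA : immersed_submanifold S A.

Lemma immersed_chart_at x : S x -> exists c u, [/\ A c, chart_dom c u & c u = x].
Proof. by case: SA => _ -> _ [c Ac [u cu <-]]; exists c, u. Qed.

Lemma immersed_mem c u : A c -> chart_dom c u -> S (c u).
Proof. by case: SA => _ -> _ Ac cu; exists c => //; exists u. Qed.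

Lemma immersed_open c : A c -> open (chart_dom c).
Proof. by case: SA => H _ _ /H[]. Qed.

Lemma immersed_smooth c : A c -> smooth_on (chart_dom c) c.
Proof. by case: SA => H _ _ /H[]. Qed.

Lemma immersed_diff c u : A c -> chart_dom c u -> differentiable c u.
Proof. by move=> /immersed_smooth; exact: smooth_on_diff. Qed.

(** A map that is smooth for the manifold structure factors locally through a
    chart, so the chain rule puts its derivatives in the tangent space. *)
Lemma smooth_into_tangent (E : normedModType R) (U : set E) (f : E -> V) u c w :
  smooth_into A U f -> U u -> A c -> chart_dom c w -> c w = f u ->
  differentiable f u /\ forall v, exists v', 'D_v f u = 'd c w v'.
Proof.
move=> [_ /(_ c)] H Uu Ac cw cwu; case: (H Ac) => {H} oW [theta [sth th]].
have Wu : (U `&` f @^-1` chart_im c) u by split => //; exists w.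
have thu : theta u = w.
  case: SA => /(_ c Ac) [_ _ inj _] _ _; have [dth cth] := th _ Wu.
  by apply: inj; rewrite ?inE// cth cwu.
have dt : differentiable theta u by exact: smooth_on_diff sth _.
have dcw : differentiable c (theta u) by rewrite thu; exact: immersed_diff.
have near_f : \forall y \near u, f y = (c \o theta) y.
  have : \forall y \near u, (U `&` f @^-1` chart_im c) y by exact: open_nbhs_nbhs.
  by apply: filterS => y /th [_ /= ->].
have dct : differentiable (c \o theta) u by exact: differentiable_comp.
have [df dfE] := near_eq_diff dct near_f.
split=> // v; exists ('d theta u v).
rewrite (deriveE _ df) dfE (diff_comp dt dcw) -thu.
exact: erefl.
Qed.
End Charts.

Section Lines.
Variables (R : realType) (E : normedModType R).

Lemma is_derive_line (F : E -> R) (u v : E) (t : R) : derivable F (t *: v + u) v ->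
  is_derive t 1 (fun s : R => F (s *: v + u)) ('D_v F (t *: v + u)).
Proof.
move=> dF.
have H : (fun h : R => h^-1 *: (F ((h *: (1 : R) + t) *: v + u) - F (t *: v + u))) =
   (fun h : R => h^-1 *: (F (h *: v + (t *: v + u)) - F (t *: v + u))).
  apply/funext => h; congr (_ *: (F _ - _)).
  by rewrite scalerDl addrA -[h *: (1 : R)]/(h * 1) mulr1.
apply: DeriveDef.
  by rewrite /derivable /= H.
by rewrite /derive /= H.
Qed.

Lemma zero_derive_locally_cst (U : set E) (F : E -> R) (u : E) :
  open U -> (forall x, U x -> differentiable F x) ->
  (forall x v, U x -> 'D_v F x = 0) -> U u -> \forall x \near u, F x = F u.
Proof.
move=> oU dF F0 Uu.
have /nbhs_ballP [e /= e0 He] : nbhs u U by exact: open_nbhs_nbhs.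
near=> x.
have xe : `|x - u| < e.
  near: x; apply/nbhs_ballP; exists e => // y.
  by rewrite -ball_normE /= distrC.
have inU (t : R) : 0 <= t <= 1 -> U (t *: (x - u) + u).
  move=> /andP[t0 t1]; apply: He; rewrite -ball_normE /= opprD addrCA subrr addr0.
  rewrite normrN normrZ ger0_norm//; apply: le_lt_trans xe.
  by rewrite ler_piMl.
have D (t : R) : 0 <= t <= 1 -> is_derive t 1 (fun s : R => F (s *: (x - u) + u)) 0.
  move=> /inU Ut; rewrite -(F0 _ (x - u) Ut); apply: is_derive_line.
  exact/diff_derivable/dF.
have : {within `[0, 1], continuous (fun s : R => F (s *: (x - u) + u) : R)}.
  apply: derivable_within_continuous => t; rewrite in_itv/= => /D H.
  exact: ex_derive.
move=> /(@MVT_segment _ _ (fun=> 0) _ _ ler01) [].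
  by move=> t /andP[t0 t1]; apply: D; rewrite !ltW.
move=> c _; rewrite mul0r scale1r scale0r add0r subrK => /eqP.
by rewrite subr_eq0 => /eqP.
Unshelve. all: by end_near. Qed.
End Lines.

(** * Connected Lie subgroups *)

Section LieGroup.
Variables (R : realType) (d : nat) (G : set (conf_space R)).
Variable (A : set (chart (conf_space R) d)).
Hypothesis GA : connected_lie_subgroup G A.
Implicit Types (g h t : conf_space R) (c : chart (conf_space R) d) (x y : 'cV[R]_3).

Let GS : conf_subgroup G. Proof. by case: GA => -[]. Qed.
Let GI : immersed_submanifold G A. Proof. by case: GA => -[]. Qed.

(** The elements that satisfy [P] and those that do not form two disjoint open
    sets of the manifold topology. *)
Lemma lie_connected_ind (P : conf_space R -> Prop) :
  (forall c u, A c -> chart_dom c u -> \forall u' \near u, P (c u') <-> P (c u)) ->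
  P (cone R) -> forall g, G g -> P g.
Proof.
move=> Ploc P1 g Gg.
have op (Q : conf_space R -> Prop) :
    (forall c u, A c -> chart_dom c u -> Q (c u) -> \forall u' \near u, Q (c u')) ->
    manifold_open A (G `&` Q).
  move=> Qloc c Ac; rewrite openE => u [cu [_ Qu]].
  have : \forall u' \near u, chart_dom c u'.
    by apply: open_nbhs_nbhs; split => //; exact: (immersed_open GI).
  rewrite /interior; near_simpl => H; near=> u'.
  have cu' : chart_dom c u' by near: u'.
  split=> //; split; first exact: (immersed_mem GI).
  by near: u'; exact: Qloc.
have o1 : manifold_open A (G `&` P).
  by apply: op => c u Ac cu Pu; move: (Ploc c u Ac cu); apply: filterS => u' ->.
have o2 : manifold_open A (G `&` ~` P).
  apply: op => c u Ac cu Pu; move: (Ploc c u Ac cu); apply: filterS => u' H.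
  by move=> /H.
have [] := GA.2 _ _ o1 o2.
- rewrite -setIUr; have -> : P `|` ~` P = setT by exact: setUv.
  by rewrite setIT.
- by rewrite setIACA setIid setICr setI0.
- by case: GS => _ G1 _ _ E; have : (G `&` P) (cone R) by []; rewrite E.
- move=> E; apply: contrapT => nP.
  by have : (G `&` ~` P) g by []; rewrite E.
Unshelve. all: by end_near. Qed.

(** This gives the positivity of the scale factors, and the fact that [G] does
    not exchange the two sides of an invariant plane. *)
Lemma lie_sign (phi : conf_space R -> R) : continuous phi ->
  (forall g, G g -> phi g != 0) -> 0 < phi (cone R) -> forall g, G g -> 0 < phi g.
Proof.
move=> cphi nz p1; apply: lie_connected_ind p1 => c u Ac cu.
have cc : {for u, continuous (phi \o c)}.
  apply: continuous_comp; last exact: cphi.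
  exact/differentiable_continuous/(immersed_diff GI).
have := nz _ (immersed_mem GI Ac cu); rewrite neq_lt => /orP[neg|pos].
  have : \forall u' \near u, phi (c u') < 0.
    by apply: (cvgr_lt _ cc).
  by apply: filterS => u' n'; split; rewrite ltNge ?(ltW neg) ?(ltW n').
have : \forall u' \near u, 0 < phi (c u').
  by apply: (cvgr_gt _ cc).
by apply: filterS => u' n'; split.
Qed.

(** The product of two charts is smooth for the manifold structure, so that its
    derivative is tangent to [G] at the product. *)
Lemma tangent_mul c1 u1 c2 u2 c u w1 w2 : A c1 -> A c2 -> A c ->
  chart_dom c1 u1 -> chart_dom c2 u2 -> chart_dom c u -> c u = cmul (c1 u1) (c2 u2) ->
  exists w, 'd c u w = dcmul (c1 u1) (c2 u2) ('d c1 u1 w1) ('d c2 u2 w2).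
Proof.
move=> A1 A2 Ac d1 d2 dc cE.
have sm : smooth_into A (chart_dom c1 `*` chart_dom c2)
    (fun u : 'rV[R]_d * 'rV[R]_d => cmul (c1 u.1) (c2 u.2)).
  by case: GA => -[_ _ H _] _; exact: H.
have [|df /(_ (w1, w2)) [w Hw]] :=
  @smooth_into_tangent _ _ _ _ _ GI _ _ _ (u1, u2) c u sm _ Ac dc cE; first by [].
exists w; apply: etrans (esym Hw) _ => {Hw}.
have df1 : differentiable c1 u1 by exact: (immersed_diff GI).
have df2 : differentiable c2 u2 by exact: (immersed_diff GI).
have dfst : is_diff (u1, u2) (fst : 'rV[R]_d * 'rV[R]_d -> _) fst.
  apply: DiffDef; first by apply: linear_differentiable => ?; exact: cvg_fst.
  by apply: diff_lin => ?; exact: cvg_fst.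
have dsnd : is_diff (u1, u2) (snd : 'rV[R]_d * 'rV[R]_d -> _) snd.
  apply: DiffDef; first by apply: linear_differentiable => ?; exact: cvg_snd.
  by apply: diff_lin => ?; exact: cvg_snd.
have D1 : differentiable (c1 \o fst) (u1, u2) by exact: differentiable_comp.
have D2 : differentiable (c2 \o snd) (u1, u2) by exact: differentiable_comp.
apply: etrans
  (@derive_cmul _ _ (c1 \o fst) (c2 \o snd) (u1, u2) (w1, w2) D1 D2 df) _.
have -> : 'D_(w1, w2) (c1 \o fst) (u1, u2) = 'd c1 u1 w1.
  rewrite (deriveE _ D1).
  rewrite (@diff_comp _ _ _ _ fst c1 _ (@ex_diff _ _ _ _ _ _ _ dfst) df1).
  by rewrite /= (@diff_val _ _ _ _ _ _ _ dfst).
have -> : 'D_(w1, w2) (c2 \o snd) (u1, u2) = 'd c2 u2 w2.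
  rewrite (deriveE _ D2).
  rewrite (@diff_comp _ _ _ _ snd c2 _ (@ex_diff _ _ _ _ _ _ _ dsnd) df2).
  by rewrite /= (@diff_val _ _ _ _ _ _ _ dsnd).
by [].
Qed.

Lemma tangent_dcmul c1 u1 c2 u2 c u g1 g2 t1 t2 : A c1 -> A c2 -> A c ->
  chart_dom c1 u1 -> chart_dom c2 u2 -> chart_dom c u ->
  c1 u1 = g1 -> c2 u2 = g2 -> c u = cmul g1 g2 ->
  range ('d c1 u1) t1 -> range ('d c2 u2) t2 ->
  range ('d c u) (dcmul g1 g2 t1 t2).
Proof.
move=> A1 A2 Ac d1 d2 dc <- <- E [w1 _ <-] [w2 _ <-].
have [w Hw] := tangent_mul w1 w2 A1 A2 Ac d1 d2 dc E.
by exists w.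
Qed.

Lemma tangent0 c u : range ('d c u) 0.
Proof. by exists 0 => //; exact: linear0. Qed.

End LieGroup.

(** * Linear algebra *)

Section LinearAlgebra.
Variable R : realType.

(** A row space is the kernel of its cokernel matrix, hence it is closed. *)
Lemma row_space_closed m n (N : 'M[R]_(m, n)) (v : 'rV[R]_n) :
  (forall e, 0 < e ->
     exists2 v' : 'rV[R]_n, (v' <= N)%MS & forall j, `|v' 0 j - v 0 j| < e) ->
  (v <= N)%MS.
Proof.
move=> H; rewrite submxE; apply/eqP/matrixP => i j; rewrite ord1 [RHS]mxE.
set C := cokermx N.
apply/eqP; rewrite -normr_le0; apply/ler_addgt0Pl => e e0; rewrite addr0.
pose K := \sum_k `|C k j|; have K0 : 0 <= K by apply: sumr_ge0.
have [v' v'N v'v] := H (e / (K + 1)) (divr_gt0 e0 (ltr_wpDl K0 ltr01)).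
have -> : (v *m C) 0 j = ((v - v') *m C) 0 j.
  by move: v'N; rewrite submxE => /eqP E; rewrite mulmxBl E subr0.
rewrite mxE; apply: le_trans (ler_norm_sum _ _ _) _.
apply: (@le_trans _ _ (e / (K + 1) * K)).
  rewrite mulr_sumr; apply: ler_sum => k _; rewrite normrM ler_wpM2r//.
  by have /ltW := v'v k; rewrite distrC !mxE.
rewrite mulrAC ler_pdivrMr ?ltr_wpDl// ler_wpM2l//; first exact: ltW.
by rewrite lerDl.
Qed.

Lemma linear_form_bounded n (phi : 'rV[R]_n -> R^o) : linear phi ->
  exists2 K : R, 0 <= K &
    forall (v : 'rV[R]_n) Z, (forall i, `|v 0 i| <= Z) -> `|phi v| <= K * Z.
Proof.
move=> lphi.
pose phiL : {linear 'rV[R]_n -> R^o} :=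
  HB.pack phi (GRing.isLinear.Build R 'rV[R]_n R^o _ _ lphi).
exists (\sum_i `|phi (delta_mx 0 i)|) => [|v Z vZ]; first exact: sumr_ge0.
rewrite -[phi]/(phiL : _ -> _) {1}(row_sum_delta v) linear_sum /=.
apply: le_trans (ler_norm_sum _ _ _) _; rewrite mulr_suml; apply: ler_sum => i _.
by rewrite -[phi]/(phiL : _ -> _) linearZ /= normrM mulrC ler_wpM2l.
Qed.

Lemma orthogonal_tr n (M : 'M[R]_n) : M *m M^T = 1%:M -> M^T *m M = 1%:M.
Proof. exact: mulmx1C. Qed.

Lemma orthogonal_entry_le1 n (M : 'M[R]_n) i j : M *m M^T = 1%:M -> `|M i j| <= 1.
Proof.
move=> /matrixP /(_ i i); rewrite !mxE eqxx /= => E.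
rewrite -[leRHS]sqrtr1 -sqrtr_sqr ler_sqrt// -[leRHS]E (bigD1 j)//= mxE expr2 lerDl.
by apply: sumr_ge0 => k _; rewrite mxE -expr2 sqr_ge0.
Qed.

Lemma mulmx_entry_le m n p (M : 'M[R]_(m, n)) (N : 'M[R]_(n, p)) a b i j :
  0 <= a -> (forall i j, `|M i j| <= a) -> (forall i j, `|N i j| <= b) ->
  `|(M *m N) i j| <= n%:R * (a * b).
Proof.
move=> a0 Ma Nb; rewrite mxE; apply: le_trans (ler_norm_sum _ _ _) _.
apply: le_trans (_ : \sum_(k < n) a * b <= _).
  by apply: ler_sum => k _; rewrite normrM ler_pM.
by rewrite sumr_const card_ord mulr_natl.
Qed.

End LinearAlgebra.

(** * Algebra of the conformal group *)

Section ConfAlgebra.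
Variable R : realType.
Implicit Types (g h t s : conf_space R) (x y : 'cV[R]_3).

(** The velocity at [y] of the infinitesimal motion [t]: the derivative at the
    identity, in the direction [t], of the map sending [g] to [cact g y]. *)
Definition inf_act t y : 'cV[R]_3 := cscale t *: y + clin t *m y + ctrans t.

Lemma inf_act_linear y : linear (inf_act ^~ y).
Proof.
move=> a t s; rewrite /inf_act.
rewrite -[cscale (_ + _)]/(a * cscale t + cscale s).
rewrite -[clin (_ + _)]/(a *: clin t + clin s).
rewrite -[ctrans (_ + _)]/(a *: ctrans t + ctrans s).
rewrite mulmxDl -scalemxAl !scalerDl !scalerDr scalerA.
apply/matrixP => i j; rewrite !mxE; ring.
Qed.

Lemma conf_scale_neq0 g : Conf g -> cscale g != 0. Proof. by case. Qed.
Lemma conf_orth g : Conf g -> clin g *m (clin g)^T = 1%:M. Proof. by case. Qed.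
Lemma conf_orth' g : Conf g -> (clin g)^T *m clin g = 1%:M.
Proof. by move=> /conf_orth /orthogonal_tr. Qed.

Lemma cact_cmul g h x : cact (cmul g h) x = cact g (cact h x).
Proof.
rewrite /cact [cscale _]/= [clin _]/= [ctrans _]/= mulmxDr -scalemxAr mulmxA.
by rewrite scalerDr scalerA addrA.
Qed.

Lemma cact_one x : cact (cone R) x = x.
Proof. by rewrite /cact [cscale _]/= [clin _]/= [ctrans _]/= scale1r mul1mx addr0. Qed.

Lemma cactK g : Conf g -> cancel (cact g) (cact (cinv g)).
Proof.
move=> Cg x; rewrite /cact [cscale (cinv _)]/= [clin (cinv _)]/= [ctrans (cinv _)]/=.
rewrite mulmxDr -scalemxAr mulmxA (conf_orth' Cg) mul1mx scalerDr scalerA.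
by rewrite mulVf ?(conf_scale_neq0 Cg)// scale1r addrK.
Qed.

Lemma cactKV g : Conf g -> cancel (cact (cinv g)) (cact g).
Proof.
move=> Cg x; rewrite /cact [cscale (cinv _)]/= [clin (cinv _)]/= [ctrans (cinv _)]/=.
rewrite mulmxDr mulmxN -!scalemxAr !mulmxA (conf_orth Cg) !mul1mx scalerBr !scalerA.
by rewrite mulfV ?(conf_scale_neq0 Cg)// !scale1r subrK.
Qed.

Lemma cmulV g : Conf g -> cmul (cinv g) g = cone R.
Proof.
move=> Cg; rewrite /cmul [cscale (cinv _)]/= [clin (cinv _)]/= [ctrans (cinv _)]/=.
by rewrite mulVf ?(conf_scale_neq0 Cg)// (conf_orth' Cg) subrr.
Qed.

Lemma cmul1g g : cmul (cone R) g = g.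
Proof.
case: g => [[a M] v]; rewrite /cmul /cone /cmk /cscale /clin /ctrans /=.
by rewrite mul1r mul1mx mul1mx scale1r addr0.
Qed.

Lemma Conf_cmul g h : Conf g -> Conf h -> Conf (cmul g h).
Proof.
move=> [g1 g2] [h1 h2]; split; first by rewrite [cscale _]/= mulf_neq0.
by rewrite [clin _]/= trmx_mul mulmxA -(mulmxA _ _ (clin h)^T) h2 mulmx1.
Qed.

Lemma Conf_cinv g : Conf g -> Conf (cinv g).
Proof.
move=> Cg; split; first by rewrite [cscale _]/= invr_eq0 conf_scale_neq0.
by rewrite [clin _]/= trmxK conf_orth'.
Qed.

Lemma Conf_cone : Conf (cone R).
Proof. by split; rewrite ?[cscale _]/= ?[clin _]/= ?oner_neq0// trmx1 mulmx1. Qed.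

End ConfAlgebra.

(** * The tangent space at the identity *)

(** Right translation by [g], then left translation by its inverse: the adjoint
    action.  Expressed through velocities it does not involve the translation
    parts, which makes it independent of the choice of an origin. *)
Lemma dcmul_Ad (R : realType) (g t : conf_space R) : Conf g ->
  let t' := dcmul (cinv g) g 0 (dcmul (cone R) g t 0) in
  [/\ cscale t' = cscale t, clin t' = (clin g)^T *m clin t *m clin g &
   forall y, inf_act t' y = (cscale g)^-1 *: ((clin g)^T *m inf_act t (cact g y))].
Proof.
move: g t => [[b B] p] [[a S] v] [/= b0 BB].
have BB' : B^T *m B = 1%:M by exact: orthogonal_tr.
rewrite /inf_act /cact /dcmul /dcact /cmk /cinv /cone /cscale /clin /ctrans /= in b0 BB BB' *.
rewrite !(mul0r, mul0mx, scale0r, scaler0, add0r, mul1mx, mul1r, scale1r,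
  mulmx0, addr0, mulr0).
split.
- by rewrite mulrCA mulVf// mulr1.
- by rewrite mulmxA.
- move=> y.
  rewrite !mulmxDr -!scalemxAr !mulmxDr !scalerDr !scalerA !mulmxA.
  rewrite -!scalemxAr !scalerA.
  rewrite (mulmxA B^T B y) BB' mul1mx mulVf// scale1r mulrA !addrA.
  by congr (_ + _); congr (_ + _); rewrite -!addrA; congr (_ + _); exact: addrC.
Qed.

Section TangentSpace.
Variables (R : realType) (d : nat) (G : set (conf_space R)).
Variable (A : set (chart (conf_space R) d)).
Hypothesis GA : connected_lie_subgroup G A.
Implicit Types (g h t s : conf_space R) (c : chart (conf_space R) d) (x y : 'cV[R]_3).

Let GS : conf_subgroup G. Proof. by case: GA => -[]. Qed.
Let GI : immersed_submanifold G A. Proof. by case: GA => -[]. Qed.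
Let GC g : G g -> Conf g. Proof. by case: GS => H _ _ _ /H. Qed.
Let GV g : G g -> G (cinv g). Proof. by case: GS => _ _ _; apply. Qed.

Variables (c0 : chart (conf_space R) d) (u0 : 'rV[R]_d).
Hypotheses (Ac0 : A c0) (cu0 : chart_dom c0 u0) (c0u0 : c0 u0 = cone R).

Let T : set (conf_space R) := range ('d c0 u0).

Lemma tangent_lin a t s : T t -> T s -> T (a *: t + s).
Proof. by move=> [w _ <-] [w' _ <-]; exists (a *: w + w') => //; rewrite linearP. Qed.

(** Left translation to the identity. *)
Lemma dcact_chart c u w : A c -> chart_dom c u ->
  exists2 t, T t & forall y,
    dcact (c u) ('d c u w) y = cscale (c u) *: (clin (c u) *m inf_act t y).
Proof.
move=> Ac cu; have Gg := immersed_mem GI Ac cu; have Cg := GC Gg.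
have [c' [u' [Ac' cu' E']]] := immersed_chart_at GI (GV Gg).
have [s sE] : exists s, s = 'd c u w by exists ('d c u w).
have Ts : range ('d c u) s by exists w.
have E0 : c0 u0 = cmul (cinv (c u)) (c u) by rewrite c0u0 cmulV.
have := tangent_dcmul GA Ac' Ac Ac0 cu' cu cu0 E' erefl E0 (tangent0 c' u') Ts.
move=> Tt; exists (dcmul (cinv (c u)) (c u) 0 s); first exact: Tt.
move=> y; apply: etrans (_ : dcact (c u) s y = _); first by congr dcact.
move: (c u) s Cg {Gg E' E0 Ts Tt sE} => [[b B] p] [[a S] v] [/= b0 BB].
rewrite /inf_act /dcmul /dcact /cmk /cinv /cscale /clin /ctrans /= in b0 BB *.
rewrite !(mul0r, mul0mx, scale0r, scaler0, add0r).
rewrite !mulmxDr -!scalemxAr !mulmxA BB !mul1mx !scalerDr !scalerA.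
by rewrite !mulrA mulfV// mul1r scale1r.
Qed.

(** Both translations preserve the family of tangent spaces of [G], so their
    composite maps the one at the identity to itself. *)
Lemma tangent_Ad g t : G g -> T t -> exists2 t', T t' &
  [/\ cscale t' = cscale t, clin t' = (clin g)^T *m clin t *m clin g &
   forall y, inf_act t' y = (cscale g)^-1 *: ((clin g)^T *m inf_act t (cact g y))].
Proof.
move=> Gg Tt; have Cg := GC Gg.
have [c [u [Ac cu cE]]] := immersed_chart_at GI Gg.
have [c' [u' [Ac' cu' E']]] := immersed_chart_at GI (GV Gg).
have E1 : c u = cmul (cone R) g by rewrite cmul1g.
have T1 := tangent_dcmul GA Ac0 Ac Ac cu0 cu cu c0u0 cE E1 Tt (tangent0 c u).
have E0 : c0 u0 = cmul (cinv g) g by rewrite c0u0 cmulV.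
have T2 := tangent_dcmul GA Ac' Ac Ac0 cu' cu cu0 E' cE E0 (tangent0 c' u') T1.
exists (dcmul (cinv g) g 0 (dcmul (cone R) g t 0)); first exact: T2.
exact: dcmul_Ad.
Qed.

End TangentSpace.

(** * Splitting off the translation part *)

Section Splitting.
Variables (R : realType) (d : nat) (G : set (conf_space R)).
Variable L : {linear 'rV[R]_d -> conf_space R}.
Implicit Types (g h t s : conf_space R) (x y : 'cV[R]_3).
Let T := range L.
Hypothesis GV : forall g, G g -> G (cinv g).
Hypothesis GC : G `<=` @Conf R.
Hypothesis Ad : forall g t, G g -> T t -> exists2 t', T t' &
  [/\ cscale t' = cscale t, clin t' = (clin g)^T *m clin t *m clin g &
   forall y, inf_act t' y = (cscale g)^-1 *: ((clin g)^T *m inf_act t (cact g y))].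
Variable p : 'cV[R]_3.

(** The translation part is replaced by the velocity at [p]; the adjoint action
    of a map that fixes [p] is then diagonal by blocks. *)
Let crow t : 'rV[R]_(1 + 3 * 3 + 3) :=
  row_mx (row_mx (cscale t)%:M (mxvec (clin t))) (inf_act t p)^T.

Let crow_linear : linear crow.
Proof.
move=> a t s; rewrite /crow inf_act_linear.
rewrite -[cscale (_ + _)]/(a * cscale t + cscale s).
rewrite -[clin (_ + _)]/(a *: clin t + clin s).
rewrite (linearP mxvec) (linearP trmx).
have -> : (a * cscale t + cscale s)%:M =
    a *: (cscale t)%:M + (cscale s)%:M :> 'M[R]_1.
  by rewrite raddfD /= scale_scalar_mx.
by rewrite !scale_row_mx !add_row_mx.
Qed.

Let crow_inj t s : crow t = crow s -> t = s.
Proof.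
move=> /eq_row_mx [/eq_row_mx [/(congr1 (fun M : 'M[R]_1 => M 0 0))]].
rewrite !mxE eqxx !mulr1n => sE /(congr1 vec_mx); rewrite !mxvecK => lE.
move=> /trmx_inj; rewrite /inf_act sE lE => /addrI tE.
by apply: conf_eqP => [|i j|i]; rewrite ?sE ?lE ?tE.
Qed.

Let N : 'M[R]_(d, _) := lin1_mx (crow \o L).

Let mulN w : w *m N = crow (L w).
Proof.
have lin : linear (crow \o L) by move=> a u v; rewrite /= linearP crow_linear.
pose f : {linear 'rV[R]_d -> 'rV[R]_(1 + 3 * 3 + 3)} := HB.pack (crow \o L)
  (GRing.isLinear.Build R 'rV[R]_d 'rV[R]_(1 + 3 * 3 + 3) _ _ lin).
by rewrite -[RHS]/(f w) -mul_rV_lin1.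
Qed.

Let memT t : T t <-> (crow t <= N)%MS.
Proof.
split; first by move=> [w _ <-]; rewrite -mulN submxMl.
by move=> /submxP [w]; rewrite mulN => /crow_inj ->; exists w.
Qed.

(** A subspace of finite dimension is closed. *)
Lemma range_closed s :
  (forall e, 0 < e -> exists2 t, T t & [/\ `|cscale t - cscale s| < e,
    forall i j, `|clin t i j - clin s i j| < e & inf_act t p = inf_act s p]) -> T s.
Proof.
move=> H; apply/memT/row_space_closed => e e0.
have [t /memT Tt [Hs Hl Hi]] := H e e0; exists (crow t) => // j.
rewrite /crow Hi !mxE; case: splitP => k _; last by rewrite subrr normr0.
rewrite !mxE; case: splitP => l _; first by rewrite !mxE ord1 eqxx !mulr1n.
by case/mxvec_indexP: l => a b; rewrite !mxvecE.
Qed.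

(** The map sending an element of [T] to its velocity at [p] has a linear
    section, which is bounded because dimensions are finite. *)
Lemma bounded_lift : exists2 K : R, 0 <= K & forall t (Z : R), T t ->
  (forall i, `|inf_act t p i 0| <= Z) ->
  exists2 t', T t' & [/\ inf_act t' p = inf_act t p, `|cscale t'| <= K * Z &
    forall i j, `|clin t' i j| <= K * Z].
Proof.
pose Y : 'M[R]_(d, 3) := rsubmx N.
pose lift (z : 'rV[R]_3) := L (z *m pinvmx Y).
have lift_lin : linear lift by move=> a u v; rewrite /lift mulmxDl -scalemxAl linearP.
have mulY w : w *m Y = (inf_act (L w) p)^T by rewrite mulmx_rsub mulN row_mxKr.
have [Ks Ks0 HKs] : exists2 K : R, 0 <= K & forall (v : 'rV[R]_3) Z,
    (forall i, `|v 0 i| <= Z) -> `|cscale (lift v)| <= K * Z.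
  by apply: linear_form_bounded => a u v; rewrite lift_lin cscale_linear.
have Kl i j : {K : R | 0 <= K & forall (v : 'rV[R]_3) Z,
    (forall i, `|v 0 i| <= Z) -> `|clin (lift v) i j| <= K * Z}.
  by apply/cid2/linear_form_bounded => a u v; rewrite lift_lin clin_linear.
pose K := Ks + \sum_i \sum_j s2val (Kl i j).
have Kl0 i j : 0 <= s2val (Kl i j) by case: (Kl i j).
have Kl_le i j : s2val (Kl i j) <= K.
  rewrite /K (bigD1 i)//= (bigD1 j)//= addrCA -!addrA lerDl.
  rewrite addr_ge0// ?sumr_ge0// => *; rewrite ?addr_ge0 ?sumr_ge0// => *.
  by rewrite sumr_ge0.
have Ks_le : Ks <= K by rewrite lerDl sumr_ge0// => i _; rewrite sumr_ge0.
exists K; first exact: le_trans Ks_le.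
move=> t Z [w _ <-] HZ.
have Z0 : 0 <= Z by apply: le_trans (HZ 0).
have HZ' i : `|(inf_act (L w) p)^T 0 i| <= Z by rewrite mxE.
exists (lift (inf_act (L w) p)^T); first by eexists.
split.
- by apply: trmx_inj; rewrite /lift -(mulY w) -mulY mulmxKpV// submxMl.
- by apply: le_trans (HKs _ _ HZ') _; rewrite ler_wpM2r.
- move=> i j; apply: le_trans (_ : s2val (Kl i j) * Z <= _); last by rewrite ler_wpM2r.
  by case: (Kl i j) => K' K'0 /= /(_ _ _ HZ').
Qed.

(** Under the adjoint action, a contraction [h] that fixes [p] multiplies the
    velocities at [p] by [(cscale h)^-1] while the linear parts stay bounded.
    After rescaling by [cscale h] the linear part tends to 0, and [T] is
    closed. *)
Lemma translation_part t :
  (forall e, 0 < e -> exists2 h, G h & cact h p = p /\ 0 < cscale h < e) ->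
  T t -> T (cmk 0 0 (inf_act t p)).
Proof.
move=> contr Tt; set y := inf_act t p.
pose Z := \sum_i `|y i 0| + 1.
have Z0 : 0 < Z by rewrite ltr_wpDl ?sumr_ge0.
have yZ i j : `|y i j| <= Z.
  rewrite ord1 /Z (bigD1 i)//= -addrA lerDl addr_ge0// sumr_ge0//.
have [K K0 lift] := bounded_lift; have Z0' := ltW Z0.
apply: range_closed => e e0.
have fin : inf_act (cmk 0 0 y) p = y.
  by rewrite /inf_act [cscale _]/= [clin _]/= scale0r mul0mx !add0r.
(* [M] bounds the scale and linear parts of the vector [t1] found below, so
   that [cscale h < e / M] makes them smaller than [e] after rescaling *)
pose M := 3%:R * (3%:R * (1 * (K * (3%:R * (1 * Z))))) + K * (3%:R * (1 * Z)) + 1.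
have KZ0 : 0 <= K * (3%:R * (1 * Z)) by rewrite !mulr_ge0.
have M0 : 0 < M by rewrite ltr_wpDl// addr_ge0// !mulr_ge0.
have [h Gh [hp /andP[h0 he]]] := contr (e / M) (divr_gt0 e0 M0).
have Ch := GC Gh; have orth := conf_orth Ch.
have orth1 i j := orthogonal_entry_le1 i j orth.
(* the image of [y] under [clin h] is again the velocity at [p] of a vector of
   [T]: it is to that vector that the expansion is applied *)
have [s Ts sE] : exists2 s, T s & inf_act s p = clin h *m y.
  have [t' Tt' [_ _ /(_ p)]] := Ad (GV Gh) Tt.
  have hVp : cact (cinv h) p = p by rewrite -{1}hp cactK.
  rewrite hVp [cscale (cinv _)]/= [clin (cinv _)]/= trmxK invrK => t'E.
  exists ((cscale h)^-1 *: t').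
    by case: Tt' => w _ <-; exists ((cscale h)^-1 *: w) => //; rewrite linearZ.
  rewrite -[_ *: t']addr0 inf_act_linear t'E.
  have -> : inf_act 0 p = 0 :> 'cV[R]_3.
    by rewrite /inf_act [cscale _]/= [clin _]/= [ctrans _]/= scale0r mul0mx !addr0.
  by rewrite addr0 scalerA mulVf ?gt_eqF// scale1r.
have sZ i : `|inf_act s p i 0| <= 3%:R * (1 * Z).
  by rewrite sE; apply: mulmx_entry_le.
have [s1 Ts1 [s1E s1s s1l]] := lift _ _ Ts sZ.
have [t1 [w1 _ Lw1] [t1s t1l /(_ p)]] := Ad Gh Ts1.
rewrite hp s1E sE mulmxA (conf_orth' Ch) mul1mx => t1p.
have small a : `|a| <= M - 1 -> `|cscale h * a| < e.
  move=> aM; rewrite normrM gtr0_norm//.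
  apply: (@le_lt_trans _ _ (cscale h * (M - 1))); first by rewrite ler_pM2l.
  apply: (@lt_trans _ _ (cscale h * M)); first by rewrite ltr_pM2l// gtrBl.
  by rewrite -ltr_pdivlMr.
exists (cscale h *: t1); first by exists (cscale h *: w1) => //; rewrite linearZ /= Lw1.
split.
- rewrite [cscale (cmk _ _ _)]/= subr0 -[cscale (_ *: _)]/(cscale h * cscale t1).
  apply: small; rewrite t1s /M addrK; apply: le_trans s1s _.
  by rewrite lerDr !mulr_ge0.
- move=> i j; rewrite [clin (cmk _ _ _)]/=.
  rewrite -[clin (_ *: _)]/(cscale h *: clin t1) !mxE subr0.
  apply: small; rewrite t1l /M addrK.
  apply: le_trans (_ : _ <= 3%:R * (3%:R * (1 * (K * (3%:R * (1 * Z)))) * 1)) _.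
    apply: mulmx_entry_le => //; first by rewrite !mulr_ge0.
    by move=> a b; apply: mulmx_entry_le => // c c'; rewrite mxE.
  by rewrite mulr1 lerDl.
- rewrite fin -[_ *: t1]addr0 inf_act_linear t1p.
  have -> : inf_act 0 p = 0 :> 'cV[R]_3.
    by rewrite /inf_act [cscale _]/= [clin _]/= [ctrans _]/= scale0r mul0mx !addr0.
  by rewrite addr0 scalerA mulfV ?gt_eqF// scale1r.
Qed.
End Splitting.

(** * Local surjectivity of continuously differentiable maps *)

Lemma cvg_sum_fin (R : realType) (T : Type) (F : set_system T) (I : finType)
    (f : I -> T -> R) (a : I -> R) : Filter F ->
  (forall i, f i x @[x --> F] --> a i) ->
  (\sum_i f i x) @[x --> F] --> \sum_i a i.
Proof.
move=> FF fa; apply: cvg_big => [|i _]; last exact: fa.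
exact: add_continuous.
Qed.

Section LocalSurjection.
Variable R : realType.

Lemma mx_coord_le m n (M : 'M[R]_(m, n)) i j : `|M i j| <= `|M|.
Proof.
rewrite [leRHS]/Num.Def.normr /= mx_normrE.
exact: (le_bigmax _ (fun k => `|M k.1 k.2|) (i, j)).
Qed.

Lemma mx_norm_le m n (M : 'M[R]_(m, n)) a : 0 <= a ->
  (forall i j, `|M i j| <= a) -> `|M| <= a.
Proof.
move=> a0 Ma; rewrite /Num.Def.normr /= mx_normrE.
by apply: bigmax_le => // -[i j] _; exact: Ma.
Qed.

Lemma mx_norm_lt m n (M : 'M[R]_(m, n)) a : 0 < a ->
  (forall i j, `|M i j| < a) -> `|M| < a.
Proof.
move=> a0 Ma; rewrite /Num.Def.normr /= mx_normrE.
by apply/bigmax_ltP; split=> // -[i j] _; exact: Ma.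
Qed.

Variable k : nat.
Implicit Types (f : 'rV[R]_k -> 'rV[R]_k) (z y : 'rV[R]_k).
Local Notation e_j j := (delta_mx 0 j : 'rV[R]_k).

Lemma near_identity_expansion f i : differentiable (fun z => f z 0 i : R) 0 ->
  (forall j, 'D_(e_j j) (fun z => f z 0 i : R) 0 = (i == j)%:R) ->
  \forall z \near (0 : 'rV[R]_k), `|f z 0 i - f 0 0 i - z 0 i| <= 2^-1 * `|z|.
Proof.
move=> df Dj.
have dE z : 'd (fun z => f z 0 i : R) 0 z = z 0 i.
  rewrite [in LHS](row_sum_delta z) linear_sum /= (bigD1 i)//= big1 ?addr0.
    by rewrite linearZ /= -(deriveE _ df) Dj eqxx; exact: mulr1.
  by move=> j ji; rewrite linearZ /= -(deriveE _ df) Dj eq_sym (negbTE ji); exact: mulr0.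
have /eqaddoP /(_ 2^-1) := diff_locally df.
rewrite invr_gt0 ltr0n => /(_ isT); apply: filterS => z.
by rewrite !fctE /= addr0 opprD addrA dE.
Qed.

(** On the boundary of a small ball [f] stays away from [f 0], so that the
    squared distance from [f z] to [y], for [z] in the closed ball, is least at an
    interior point.  There its gradient vanishes, and the Jacobian matrix,
    being close to the identity, forces [f z = y]. *)
Lemma local_surjection f (U : set 'rV[R]_k) : open U -> U 0 ->
  (forall z i, U z -> differentiable (fun z => f z 0 i : R) z) ->
  (forall i j, {for 0, continuous ('D_(e_j j) (fun z => f z 0 i : R))}) ->
  (forall i j, 'D_(e_j j) (fun z => f z 0 i : R) 0 = (i == j)%:R) ->
  exists2 eta : R, 0 < eta & forall y, (forall i, `|y 0 i - f 0 0 i| < eta) ->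
    exists2 z, U z & f z = y.
Proof.
move=> oU U0 df cD D0.
(* entries within [m] of the identity make the Jacobian diagonally dominant *)
pose m := (2%:R * k.+1%:R)^-1 : R.
have m0 : 0 < m by rewrite invr_gt0 mulr_gt0.
have n1 : \forall z \near (0 : 'rV[R]_k), U z by exact: open_nbhs_nbhs.
have n2 : \forall z \near (0 : 'rV[R]_k), forall i,
    `|f z 0 i - f 0 0 i - z 0 i| <= 2^-1 * `|z|.
  apply: (@filter_forall _ _
    (fun i z => `|f z 0 i - f 0 0 i - z 0 i| <= 2^-1 * `|z|) (nbhs (0 : 'rV[R]_k)) _) => i.
  by apply: near_identity_expansion; [exact: df|exact: D0].
have n3 : \forall z \near (0 : 'rV[R]_k), forall i j,
    `|'D_(e_j j) (fun z => f z 0 i : R) z - (i == j)%:R| < m.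
  apply: (@filter_forall _ _ (fun i z => forall j,
    `|'D_(e_j j) (fun z => f z 0 i : R) z - (i == j)%:R| < m) (nbhs (0 : 'rV[R]_k)) _) => i.
  apply: (@filter_forall _ _ (fun j z =>
    `|'D_(e_j j) (fun z => f z 0 i : R) z - (i == j)%:R| < m) (nbhs (0 : 'rV[R]_k)) _) => j.
  have /cvgrPdist_lt /(_ m m0) := cD i j.
  by apply: filterS => z; rewrite D0 distrC.
have : \forall z \near (0 : 'rV[R]_k), [/\ U z,
   (forall i, `|f z 0 i - f 0 0 i - z 0 i| <= 2^-1 * `|z|) &
   (forall i j, `|'D_(e_j j) (fun z => f z 0 i : R) z - (i == j)%:R| < m)].
  by apply: filterS3 n1 n2 n3 => z a b c; split.
move=> /nbhs_ballP [r /= r0 Hr].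
pose del := r / 2; have del0 : 0 < del by rewrite divr_gt0.
have {}Hr z : `|z| <= del -> [/\ U z,
   (forall i, `|f z 0 i - f 0 0 i - z 0 i| <= 2^-1 * `|z|) &
   (forall i j, `|'D_(e_j j) (fun z => f z 0 i : R) z - (i == j)%:R| < m)].
  move=> zd; apply: Hr; rewrite -ball_normE /= sub0r normrN.
  by apply: le_lt_trans zd _; rewrite /del; lra.
(* with this [eta], the squared distance to [y] is at most [k * eta ^+ 2] at
   the centre and at least [(k.+1 * eta) ^+ 2] on the boundary *)
pose eta := del / (2 * k.+2%:R).
have eta0 : 0 < eta by rewrite divr_gt0// mulr_gt0.
exists eta => // y ye.
pose F i z := f z 0 i - y 0 i.
pose Nf z := \sum_i F i z ^+ 2.
have dF i z : `|z| <= del -> differentiable (F i) z.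
  move=> /Hr [Uz _ _]; apply: differentiableB; first exact: df.
  exact: differentiable_cst.
have DF i j z : `|z| <= del ->
    is_derive z (e_j j) (F i) ('D_(e_j j) (fun z => f z 0 i : R) z).
  move=> /Hr [Uz _ _]; have dfi : derivable (fun z => f z 0 i : R) z (e_j j).
    exact/diff_derivable/df.
  have := is_deriveB (derivableP dfi) (is_derive_cst (y 0 i : R) z (e_j j)).
  by rewrite subr0.
have DN j z : `|z| <= del -> is_derive z (e_j j) Nf
    (\sum_i 2 * F i z * 'D_(e_j j) (fun z => f z 0 i : R) z).
  move=> zd.
  have -> : Nf = \sum_i (fun z => F i z * F i z).
    by apply/funext => x; rewrite fct_sumE; apply: eq_bigr => i _; rewrite expr2.
  apply: is_derive_sum => i.
  apply: is_derive_eq (is_derive_mulR (DF i j z zd) (DF i j z zd)) _.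
  ring.
have cN z : `|z| <= del -> {for z, continuous Nf}.
  move=> zd; apply: (@cvg_sum_fin _ _ (nbhs z) 'I_k (fun i z => F i z ^+ 2)) => i.
  have cF : {for z, continuous (F i)} by exact/differentiable_continuous/dF.
  under eq_fun do rewrite expr2.
  rewrite expr2; exact: cvgM.
pose B := [set z : 'rV[R]_k | `|z| <= del].
have B0 : B !=set0 by exists 0; rewrite /B /= normr0 ltW.
have Bc : compact B.
  apply: bounded_closed_compact.
    exists del; split; first exact: num_real.
    by move=> x dx z /= zB; apply: le_trans zB _; exact: ltW.
  apply: (@closed_comp _ _ (fun z : 'rV[R]_k => `|z|) [set t | t <= del]).
    by move=> z _; exact: norm_continuous.
  exact: closed_le.
have cNB : {within B, continuous Nf}.
  apply: continuous_in_subspaceT => z; rewrite inE; exact: cN.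
have [z0 /set_mem Bz0 min0] := compact_EVT_min B0 Bc cNB.
have N0 : Nf 0 <= k%:R * eta ^+ 2.
  apply: le_trans (_ : \sum_(i < k) eta ^+ 2 <= _).
    apply: ler_sum => i _; rewrite -[leLHS]real_normK ?num_real//.
    by rewrite lerXn2r ?nnegrE ?(ltW eta0)// distrC ltW.
  by rewrite sumr_const card_ord mulr_natl.
have z0lt : `|z0| < del.
  rewrite lt_neqAle; apply/andP; split => //.
  apply/negP => /eqP z0d.
  have [i Hi] : exists i, `|z0 0 i| = del.
    apply: contrapT => H.
    suff : `|z0| < del by rewrite z0d ltxx.
    apply: mx_norm_lt => // i j; rewrite (ord1 i) lt_neqAle; apply/andP; split.
      by apply/negP => /eqP E; apply: H; exists j.
    by apply: le_trans Bz0; exact: mx_coord_le.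
  have [_ /(_ i) E _] := Hr z0 Bz0.
  have big : k.+1%:R * eta <= `|F i z0|.
    have e1 : del = 2 * k.+2%:R * eta.
      by rewrite /eta mulrCA mulfV ?mulr1// gt_eqF// mulr_gt0.
    have := ye i; rewrite /F => yi.
    have t1 : `|z0 0 i| <= `|f z0 0 i - f 0 0 i - z0 0 i| +
        `|f z0 0 i - y 0 i| + `|y 0 i - f 0 0 i|.
      have {1}-> : z0 0 i = - (f z0 0 i - f 0 0 i - z0 0 i) +
        (f z0 0 i - y 0 i) + (y 0 i - f 0 0 i) by ring.
      apply: le_trans (ler_normD _ _) _; rewrite lerD2r.
      by apply: le_trans (ler_normD _ _) _; rewrite normrN.
    rewrite Hi z0d in E t1.
    have -> : k.+1%:R = k.+2%:R - 1 :> R by rewrite -[k.+2]addn1 natrD addrK.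
    move: t1 E yi e1; set a := `| _ |; set b := `| _ |; set c := `| _ |.
    have -> : (k.+2%:R - 1) * eta = 2^-1 * (2 * k.+2%:R * eta) - eta by field.
    by move=> t1 E yi <-; lra.
  have := min0 0; rewrite inE => /(_ _).
  rewrite /B /= normr0 => /(_ (ltW del0)) mm.
  have : (k.+1%:R * eta) ^+ 2 <= k%:R * eta ^+ 2.
    apply: le_trans (le_trans mm N0).
    rewrite /Nf (bigD1 i)//= -[leLHS]addr0 lerD//; last first.
      by apply: sumr_ge0 => *; exact: sqr_ge0.
    rewrite -[leRHS]real_normK ?num_real// lerXn2r ?nnegrE// mulr_ge0// ltW//.
  rewrite exprMn ler_pM2r ?exprn_gt0// -natrX ler_nat.
  by apply/negP; rewrite -ltnNge expnS expn1 (leq_trans (ltnSn k))// leq_pmulr.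
have crit j : \sum_i 2 * F i z0 * 'D_(e_j j) (fun z => f z 0 i : R) z0 = 0.
  pose s := del - `|z0|; have s0 : 0 < s by rewrite subr_gt0.
  have inB (t : R) : t \in `]-s, s[ -> `|t *: e_j j + z0| <= del.
    rewrite in_itv /= -ltr_norml => ts.
    apply: le_trans (ler_normD _ _) _; rewrite normrZ.
    have e1 : `|e_j j| <= 1.
      apply: mx_norm_le => // a b.
      by rewrite mxE; case: (_ && _); rewrite ?normr1 ?normr0.
    rewrite -lerBrDr; apply: le_trans (ltW ts); exact: ler_piMr.
  have dl (t : R) : t \in `]-s, s[ ->
      is_derive t 1 (fun t : R => Nf (t *: e_j j + z0))
        ('D_(e_j j) Nf (t *: e_j j + z0)).
    by move=> /inB tB; apply: is_derive_line; have [] := DN j _ tB.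
  have z_in : (0 : R) \in `]-s, s[ by rewrite in_itv /= oppr_lt0 s0.
  have := @derive1_at_min R (fun t : R => Nf (t *: e_j j + z0)) (-s) s 0.
  case.
  - by rewrite lerNl; apply: le_trans (ltW s0); rewrite oppr_le0 ltW.
  - by move=> t /dl [].
  - exact: z_in.
  - move=> t /inB tB; rewrite scale0r add0r; apply: min0; exact/mem_set.
  - move=> _ E.
    have [_ E'] := dl 0 z_in; rewrite E' scale0r add0r in E.
    by have [_ <-] := DN j z0 Bz0.
have [Uz0 _ J] := Hr z0 Bz0.
exists z0 => //; apply/rowP => j.
pose S := \sum_j `|F j z0|.
have Fj i : `|F i z0| <= S * m.
  have -> : F i z0 = - \sum_l F l z0 *
      ('D_(e_j i) (fun z => f z 0 l : R) z0 - (l == i)%:R).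
    have := crit i; under eq_bigr do rewrite -mulrA.
    rewrite -mulr_sumr => /eqP; rewrite mulf_eq0 pnatr_eq0 /= => /eqP c0.
    under eq_bigr do rewrite mulrBr.
    rewrite sumrB c0 sub0r opprK (bigD1 i)//= eqxx mulr1 big1 ?addr0// => l /negbTE ->.
    by rewrite mulr0.
  rewrite normrN; apply: le_trans (ler_norm_sum _ _ _) _.
  rewrite mulr_suml; apply: ler_sum => l _; rewrite normrM ler_wpM2l// ltW//.
have S0 : 0 <= S by apply: sumr_ge0.
have SS : S <= k%:R * (S * m).
  apply: le_trans (_ : \sum_(i < k) S * m <= _); last by rewrite sumr_const card_ord mulr_natl.
  exact: ler_sum.
have {S0 SS} S0 : S = 0.
  apply/eqP; rewrite eq_le S0 andbT.
  have km : k%:R * m <= 2^-1.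
    rewrite /m invfM mulrCA ger_pMr ?invr_gt0//.
    by rewrite ler_pdivrMr ?mul1r ?ler_nat.
  have : k%:R * (S * m) <= 2^-1 * S.
    by rewrite mulrCA mulrC ler_wpM2r.
  by move=> h; move: (le_trans SS h); lra.
have : `|F j z0| <= 0 by apply: le_trans (Fj j) _; rewrite S0 mul0r.
by rewrite normr_le0 subr_eq0 => /eqP.
Qed.
End LocalSurjection.

(** * Velocities and orbits *)

Section ActionCalculus.
Variables (R : realType) (E : normedModType R).
Implicit Types (h : E -> conf_space R) (y : 'cV[R]_3).

Lemma mul_coordE m (P : 'M[R]_(m, 3)) (F : E -> 'cV[R]_3) i :
  (fun u => (P *m F u) i 0) = \sum_l (fun u => P i l * F u l 0).
Proof. by apply/funext => u; rewrite mxE fct_sumE. Qed.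

Lemma differentiable_cact h x y i : differentiable h x ->
  differentiable (fun u => cact (h u) y i 0 : R) x.
Proof.
move=> dh.
have -> : (fun u => cact (h u) y i 0 : R) =
  (fun u => cscale (h u)) * (\sum_j (fun u => clin (h u) i j) * cst (y j 0))
  + (fun u => ctrans (h u) i 0).
  by apply/funext => u; rewrite cactE [X in _ * X]mxE !fctE fct_sumE.
apply: differentiableD; last first.
  exact: differentiable_lin (@ctrans_linear R i) (@ctrans_continuous R i) dh.
apply: differentiableM.
  exact: differentiable_lin (@cscale_linear R) (@cscale_continuous R) dh.
apply: differentiable_sum => j; apply: differentiableM.
  exact: differentiable_lin (@clin_linear R i j) (@clin_continuous R i j) dh.
exact: differentiable_cst.
Qed.

Lemma differentiable_mul_cact m (P : 'M[R]_(m, 3)) h x y i : differentiable h x ->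
  differentiable (fun u => (P *m cact (h u) y) i 0 : R) x.
Proof.
move=> dh; rewrite mul_coordE; apply: differentiable_sum => l.
apply: (@differentiableM _ _ (cst (P i l)) (fun u => cact (h u) y l 0)).
  exact: differentiable_cst.
exact: differentiable_cact.
Qed.

Lemma is_derive_mul_cact m (P : 'M[R]_(m, 3)) h x v y i : differentiable h x ->
  is_derive x v (fun u => (P *m cact (h u) y) i 0 : R)
    ((P *m dcact (h x) ('D_v h x) y) i 0).
Proof.
move=> dh; rewrite mul_coordE mxE; apply: is_derive_sum => l.
have := is_derive_mulR (is_derive_cst (P i l) x v) (is_derive_cact v y l dh).
by rewrite mul0r add0r.
Qed.

Lemma cvg_dcact m (P : 'M[R]_(m, 3)) (T : Type) (F : set_system T)
    (h k : T -> conf_space R) g t y i :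
  Filter F -> h @ F --> g -> k @ F --> t ->
  (P *m dcact (h u) (k u) y) i 0 @[u --> F] --> (P *m dcact g t y) i 0.
Proof.
move=> FF hg kt.
have cs (f : T -> conf_space R) a : f @ F --> a -> cscale (f u) @[u --> F] --> cscale a.
  by move=> fa; exact: cvg_comp fa (@cscale_continuous R a).
have cl (f : T -> conf_space R) a l j : f @ F --> a ->
    clin (f u) l j @[u --> F] --> clin a l j.
  by move=> fa; exact: cvg_comp fa (@clin_continuous R l j a).
have ct (f : T -> conf_space R) a l : f @ F --> a ->
    ctrans (f u) l 0 @[u --> F] --> ctrans a l 0.
  by move=> fa; exact: cvg_comp fa (@ctrans_continuous R l a).
have cm (f : T -> conf_space R) a l : f @ F --> a ->
    (clin (f u) *m y) l 0 @[u --> F] --> (clin a *m y) l 0.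
  move=> fa; rewrite mxE; under eq_fun do rewrite mxE.
  apply: cvg_sum_fin => j; apply: cvgM; [exact: cl|exact: cvg_cst].
rewrite mxE; under eq_fun do rewrite mxE.
apply: cvg_sum_fin => l; apply: cvgM; first exact: cvg_cst.
rewrite dcactE; under eq_fun do rewrite dcactE.
apply: cvgD; last exact: ct.
by apply: cvgD; apply: cvgM; do ?[exact: cs|exact: cm].
Qed.
End ActionCalculus.

Section Orbits.
Variables (R : realType) (d : nat) (G : set (conf_space R)).
Variable (A : set (chart (conf_space R) d)).
Hypothesis GA : connected_lie_subgroup G A.
Implicit Types (g t : conf_space R) (c : chart (conf_space R) d) (x y : 'cV[R]_3).

Let GI : immersed_submanifold G A. Proof. by case: GA => -[]. Qed.

Variables (c0 : chart (conf_space R) d) (u0 : 'rV[R]_d).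
Hypotheses (Ac0 : A c0) (cu0 : chart_dom c0 u0) (c0u0 : c0 u0 = cone R).

Let T : set (conf_space R) := range ('d c0 u0).

Lemma dcact_one t y : dcact (cone R) t y = inf_act t y.
Proof.
by rewrite /dcact /inf_act [cscale (cone _)]/= [clin (cone _)]/= mul1mx scale1r.
Qed.

(** The derivative of [P *m cact g y] vanishes in all charts, since the
    velocities at [g] are, up to scaling, the images under [clin g] of those at the
    identity; and [G] is connected. *)
Lemma orbit_const m (P : 'M[R]_(m, 3)) y :
  (forall g t, G g -> T t -> P *m (clin g *m inf_act t y) = 0) ->
  forall g, G g -> P *m cact g y = P *m y.
Proof.
move=> H g Gg; apply/matrixP => i j; rewrite (ord1 j).
move: g Gg; apply: (@lie_connected_ind _ _ _ _ GA
  (fun g => (P *m cact g y) i 0 = (P *m y) i 0)); last first.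
  by rewrite cact_one.
move=> c u Ac cu.
suff : \forall u' \near u, (P *m cact (c u') y) i 0 = (P *m cact (c u) y) i 0.
  by apply: filterS => u' ->.
have cd z : chart_dom c z -> differentiable c z by exact: immersed_diff GI _ _ Ac.
apply: (@zero_derive_locally_cst _ _ (chart_dom c)) => //.
- exact: immersed_open GI _ Ac.
- by move=> z cz; apply: differentiable_mul_cact; exact: cd.
- move=> z v cz; have [_ ->] := is_derive_mul_cact P v y i (cd z cz).
  rewrite (deriveE _ (cd z cz)).
  have [t Tt ->] := dcact_chart GA Ac0 cu0 c0u0 v Ac cz.
  by rewrite -scalemxAr H ?scaler0 ?mxE//; exact: immersed_mem GI _ _ Ac cz.
Qed.

Lemma orbit_tangent_const m (P : 'M[R]_(m, 3)) y :
  (forall g, G g -> P *m cact g y = P *m y) -> forall t, T t -> P *m inf_act t y = 0.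
Proof.
move=> H t [w _ <-]; apply/matrixP => i j; rewrite (ord1 j) [RHS]mxE.
have cd : differentiable c0 u0 by exact: immersed_diff GI _ _ Ac0 cu0.
have dF := is_derive_mul_cact P w y i cd.
rewrite c0u0 dcact_one (deriveE _ cd) in dF.
have [_ <-] := dF.
have nr : \forall u \near u0, (P *m cact (c0 u) y) i 0 = cst ((P *m y) i 0) u.
  have : \forall u \near u0, chart_dom c0 u.
    by apply: open_nbhs_nbhs; split=> //; exact: immersed_open GI _ Ac0.
  by apply: filterS => u cu; rewrite H//; exact: immersed_mem GI _ _ Ac0 cu.
have [df dE] := near_eq_diff (differentiable_cst ((P *m y) i 0 : R) u0) nr.
by rewrite (deriveE _ df) dE diff_cst.
Qed.

(** Local surjectivity, on a slice of the chart at the identity whose [k]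
    directions have velocities that [P] sends to a basis. *)
Lemma orbit_open k (P : 'M[R]_(k, 3)) y :
  (forall z : 'cV[R]_k, exists2 t, T t & P *m inf_act t y = z) ->
  exists2 eta : R, 0 < eta &
    forall z : 'cV[R]_3, (forall i, `|z i 0 - y i 0| < eta) ->
    exists2 g, G g & P *m cact g y = P *m z.
Proof.
move=> surj.
have w_ (j : 'I_k) : {w | P *m inf_act ('d c0 u0 w) y = delta_mx j 0}.
  by apply/cid; have [t [w _ <-]] := surj (delta_mx j 0); exists w.
pose W := \matrix_(j < k) sval (w_ j).
have eW j : delta_mx 0 j *m W = sval (w_ j) by rewrite -rowE rowK.
pose a (s : 'rV[R]_k) := s *m W + u0.
have a0 : a 0 = u0 by rewrite /a mul0mx add0r.
pose U : set 'rV[R]_k := a @^-1` chart_dom c0.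
pose h (s : 'rV[R]_k) := c0 (a s).
have da (s : 'rV[R]_k) : differentiable a s.
  have -> : a = (\sum_j (fun s : 'rV[R]_k => s 0 j *: row j W)) + cst u0.
    by apply/funext => x; rewrite !fctE fct_sumE /a mulmx_sum_row.
  apply: differentiableD; last exact: differentiable_cst.
  apply: differentiable_sum => j; apply: differentiableZl.
  exact: differentiable_coord.
have ca : continuous a by move=> s; apply: differentiable_continuous; exact: da.
have cd u : chart_dom c0 u -> differentiable c0 u by exact: immersed_diff GI _ _ Ac0.
have dh s : U s -> differentiable h s.
  move=> Us; apply: (@differentiable_comp _ _ _ _ a c0); [exact: da|exact: cd].
have Dh s j : 'D_(delta_mx 0 j) h s = 'D_(sval (w_ j)) c0 (a s).
  have E : (fun e : R => e^-1 *: (h (e *: delta_mx 0 j + s) - h s)) =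
      (fun e : R => e^-1 *: (c0 (e *: sval (w_ j) + a s) - c0 (a s))).
    apply/funext => e; congr (_ *: (c0 _ - _)).
    by rewrite /a mulmxDl -scalemxAl eW addrA.
  by rewrite /derive /= E.
pose f s := ((P *m cact (h s) y)^T : 'rV[R]_k).
have fE i : (fun s => f s 0 i : R) = fun s => (P *m cact (h s) y) i 0.
  by apply/funext => s; rewrite mxE.
have U0 : U 0 by rewrite /U /= a0.
have Df s i j : U s -> 'D_(delta_mx 0 j) (fun s => f s 0 i : R) s =
    (P *m dcact (h s) ('D_(sval (w_ j)) c0 (a s)) y) i 0.
  move=> /dh Us; rewrite fE -Dh.
  by have [_ ->] := is_derive_mul_cact P (delta_mx 0 j) y i Us.
have oU : open U.
  apply: open_comp; first by move=> s _; exact: ca.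
  exact: immersed_open GI _ Ac0.
have df z i : U z -> differentiable (fun s => f s 0 i : R) z.
  by move=> Uz; rewrite fE; apply: differentiable_mul_cact; exact: dh.
have [i j|i j|eta eta0 Heta] := local_surjection oU U0 df.
- rewrite /prop_for /continuous_at (Df 0 i j U0).
  have nU : \forall s \near (0 : 'rV[R]_k),
      (P *m dcact (h s) ('D_(sval (w_ j)) c0 (a s)) y) i 0 =
      'D_(delta_mx 0 j) (fun s => f s 0 i : R) s.
    have : \forall s \near (0 : 'rV[R]_k), U s by exact: open_nbhs_nbhs.
    by apply: filterS => s Us; rewrite Df.
  apply: cvg_trans (near_eq_cvg nU) _.
  apply: cvg_dcact.
    exact: differentiable_continuous (dh _ U0).
  apply: (@cvg_comp _ _ _ a ('D_(sval (w_ j)) c0) _ (nbhs (a 0))).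
    exact: ca.
  apply: smooth_on_derive_cont (immersed_smooth GI Ac0) _.
  exact: U0.
- rewrite Df// /h a0 c0u0 dcact_one (deriveE _ (cd _ cu0)).
  by case: (w_ j) => w /= ->; rewrite mxE eqxx andbT.
pose K := \sum_i \sum_j `|P i j| + 1.
have K0 : 0 < K by rewrite ltr_wpDl// sumr_ge0// => i _; rewrite sumr_ge0.
exists (eta / K); first exact: divr_gt0.
move=> z zy.
have [|s Us sE] := Heta (P *m z)^T.
  move=> i; have -> : f 0 0 i = (P *m y) i 0 by rewrite /f mxE /h a0 c0u0 cact_one.
  rewrite mxE.
  have -> : (P *m z) i 0 - (P *m y) i 0 = (P *m (z - y)) i 0 by rewrite mulmxBr !mxE.
  rewrite mxE; apply: le_lt_trans (ler_norm_sum _ _ _) _.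
  apply: le_lt_trans (_ : \sum_j `|P i j| * (eta / K) < _).
    apply: ler_sum => j _; rewrite normrM ler_wpM2l// ltW//.
    by have := zy j; rewrite !mxE.
  rewrite -mulr_suml mulrCA -[ltRHS]mulr1 ltr_pM2l// ltr_pdivrMr// mul1r.
  by rewrite /K (bigD1 i)//= -addrA ltrDl ltr_wpDl// sumr_ge0// => l _; rewrite sumr_ge0.
exists (h s); first exact: immersed_mem GI _ _ Ac0 Us.
by apply: trmx_inj.
Qed.
End Orbits.

Section OpenOrbit.
Variables (R : realType) (d : nat) (G : set (conf_space R)).
Variable (A : set (chart (conf_space R) d)).
Hypothesis GA : connected_lie_subgroup G A.

Let GI : immersed_submanifold G A. Proof. by case: GA => -[]. Qed.

Variables (c0 : chart (conf_space R) d) (u0 : 'rV[R]_d).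
Hypotheses (Ac0 : A c0) (cu0 : chart_dom c0 u0) (c0u0 : c0 u0 = cone R).

Lemma linear_inj_surj n (f : {linear 'rV[R]_n -> 'cV[R]_n}) : injective f ->
  forall z, exists w, f w = z.
Proof.
move=> finj z.
pose N : 'M[R]_n := lin1_mx (trmx \o f).
have lin : linear (trmx \o f) by move=> a u v; rewrite /= !linearP.
pose h : {linear 'rV[R]_n -> 'rV[R]_n} := HB.pack (trmx \o f)
  (GRing.isLinear.Build R 'rV[R]_n 'rV[R]_n _ _ lin).
have NE w : w *m N = (f w)^T by rewrite -[RHS]/(h w) -mul_rV_lin1.
have Nu : N \in unitmx.
  rewrite -row_free_unit; apply: inj_row_free => v; rewrite NE => /eqP.
  rewrite trmx_eq0 => /eqP fv; apply: finj; rewrite fv.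
  by apply/esym; exact: linear0.
exists (z^T *m invmx N); apply: trmx_inj.
by rewrite -NE -mulmxA mulVmx// mulmx1.
Qed.

(** The orbit map is a submersion onto an orbit of dimension 3, whose tangent
    space is the whole space. *)
Lemma open_orbit_point : has_cohomogeneity G A 0 -> exists x, forall z,
  exists2 t, range ('d c0 u0) t & inf_act t x = z.
Proof.
move=> [m []]; rewrite addn0 => -> [x [B [BI Bsm Bd]]] _.
exists x => z.
have Ox : orbit_of G x (cact (c0 u0) x).
  by exists (c0 u0) => //; exact: immersed_mem GI _ _ Ac0 cu0.
have [b [w [Bb bw bE]]] := immersed_chart_at BI Ox.
have [df _] := smooth_into_tangent BI (Bsm _ Ac0) cu0 Bb bw bE.
have binj : injective ('d b w) by case: BI => /(_ b Bb) [_ _ _ H] _ _; exact: H.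
have [w1 w1E] := linear_inj_surj binj z.
have : range ('d b w) z by exists w1.
rewrite -(Bd _ _ _ _ Ac0 Bb cu0 bw bE) => -[w2 _ w2E].
exists ('d c0 u0 w2); first by exists w2.
apply/matrixP => i j; rewrite (ord1 j) -w2E -(deriveE _ df).
have cd : differentiable c0 u0 by exact: immersed_diff GI _ _ Ac0 cu0.
have phil : linear (fun v : 'cV[R]_3 => v i 0 : R^o) by move=> a u v; rewrite !mxE.
have phic : continuous (fun v : 'cV[R]_3 => v i 0 : R^o) by exact: coord_continuous.
have [_ /= <-] := is_derive_lin w2 phil phic df.
have [_ E] := is_derive_cact w2 x i cd.
by apply: etrans (esym E); rewrite c0u0 dcact_one (deriveE _ cd).
Qed.
End OpenOrbit.

(** * Euclidean geometry *)

Section Euclidean.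
Variable R : realType.
Implicit Types (u v w n x y : 'cV[R]_3) (M Q : 'M[R]_3).

Definition dot u v : R := (u^T *m v) 0 0.
Definition sqnorm v : R := dot v v.

Definition i0 : 'I_3 := @Ordinal 3 0 isT.
Definition i1 : 'I_3 := @Ordinal 3 1 isT.
Definition i2 : 'I_3 := @Ordinal 3 2 isT.

Lemma sum3 (F : 'I_3 -> R) : \sum_i F i = F i0 + F i1 + F i2.
Proof.
rewrite !big_ord_recl big_ord0 addr0 addrA.
by congr (F _ + F _ + F _); apply: val_inj.
Qed.

Lemma ord3P (P : 'I_3 -> Prop) : P i0 -> P i1 -> P i2 -> forall i, P i.
Proof.
move=> P0 P1 P2 [[|[|[|//]]] Hi].
- by rewrite (_ : Ordinal Hi = i0)//; apply: val_inj.
- by rewrite (_ : Ordinal Hi = i1)//; apply: val_inj.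
- by rewrite (_ : Ordinal Hi = i2)//; apply: val_inj.
Qed.

Lemma cV3P u v : u i0 0 = v i0 0 -> u i1 0 = v i1 0 -> u i2 0 = v i2 0 -> u = v.
Proof.
move=> H0 H1 H2; apply/matrixP => i j; rewrite (ord1 j).
by move: i; apply: ord3P.
Qed.

Lemma dot3 u v : dot u v = u i0 0 * v i0 0 + u i1 0 * v i1 0 + u i2 0 * v i2 0.
Proof. by rewrite /dot mxE sum3 !mxE. Qed.

Lemma dot_tr u v : u^T *m v = (dot u v)%:M.
Proof. by apply/matrixP => i j; rewrite !ord1 [RHS]mxE eqxx mulr1n. Qed.

Lemma dotC u v : dot u v = dot v u. Proof. by rewrite !dot3; ring. Qed.
Lemma dotDr u v w : dot u (v + w) = dot u v + dot u w.
Proof. by rewrite /dot mulmxDr mxE. Qed.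
Lemma dotZr a u v : dot u (a *: v) = a * dot u v.
Proof. by rewrite /dot -scalemxAr mxE. Qed.
Lemma dotBr u v w : dot u (v - w) = dot u v - dot u w.
Proof. by rewrite dotDr -scaleN1r dotZr mulN1r. Qed.
Lemma dotDl u v w : dot (v + w) u = dot v u + dot w u.
Proof. by rewrite dotC dotDr !(dotC u). Qed.
Lemma dotZl a u v : dot (a *: v) u = a * dot v u.
Proof. by rewrite dotC dotZr dotC. Qed.
Lemma dot_mul M u v : dot u (M *m v) = dot (M^T *m u) v.
Proof. by rewrite /dot trmx_mul trmxK mulmxA. Qed.

Lemma sqnorm_ge0 v : 0 <= sqnorm v.
Proof. by rewrite /sqnorm dot3 !addr_ge0// -expr2 sqr_ge0. Qed.

Lemma coord_le_sqnorm v i : v i 0 ^+ 2 <= sqnorm v.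
Proof.
rewrite /sqnorm dot3; move: i; have := sqr_ge0 (v i0 0); have := sqr_ge0 (v i1 0).
have := sqr_ge0 (v i2 0) => ? ? ?.
by apply: ord3P; lra.
Qed.

Lemma sqnorm_eq0 v : sqnorm v = 0 -> v = 0.
Proof.
move=> v0; apply/matrixP => i j; rewrite (ord1 j) [RHS]mxE; apply/eqP.
by rewrite -sqrf_eq0 eq_le sqr_ge0 andbT -v0 coord_le_sqnorm.
Qed.

Lemma sqnorm_gt0 v : v != 0 -> 0 < sqnorm v.
Proof.
move=> v0; rewrite lt_neqAle sqnorm_ge0 andbT eq_sym.
by apply: contra v0 => /eqP /sqnorm_eq0 ->.
Qed.

Lemma sqnormZ a v : sqnorm (a *: v) = a ^+ 2 * sqnorm v.
Proof. by rewrite /sqnorm dotZr dotZl mulrA. Qed.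

Lemma sqnormN v : sqnorm (- v) = sqnorm v.
Proof. by rewrite -scaleN1r sqnormZ sqrrN expr1n mul1r. Qed.

Lemma sqnorm_orth M v : M^T *m M = 1%:M -> sqnorm (M *m v) = sqnorm v.
Proof. by move=> MM; rewrite /sqnorm dot_mul mulmxA MM mul1mx. Qed.

Lemma sqnormD_le u v : sqnorm (u + v) <= 2 * sqnorm u + 2 * sqnorm v.
Proof.
rewrite /sqnorm !dotDl !dotDr (dotC v u).
have : 0 <= sqnorm (u - v) by exact: sqnorm_ge0.
rewrite /sqnorm !dotDl !dotDr -scaleN1r !dotZl !dotZr (dotC v u); lra.
Qed.

Definition orthproj Q := Q^T = Q /\ Q *m Q = Q.

Lemma sqnorm_proj_le Q v : orthproj Q -> sqnorm (Q *m v) <= sqnorm v.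
Proof.
move=> [Qt QQ].
have E : sqnorm (v - Q *m v) = sqnorm v - sqnorm (Q *m v).
  have e1 : dot (Q *m v) (Q *m v) = dot v (Q *m v).
    by rewrite dot_mul Qt mulmxA QQ dotC.
  rewrite /sqnorm !dotDl !dotDr -scaleN1r !dotZl !dotZr e1 (dotC (Q *m v)).
  by ring.
by rewrite -subr_ge0 -E sqnorm_ge0.
Qed.

(** The parameters at which [P] holds form an open and closed subset of the
    unit interval. *)
Lemma segment_ind (P : 'cV[R]_3 -> Prop) x y :
  (forall t : R, 0 <= t <= 1 -> exists2 rho : R, 0 < rho & forall s : R, 0 <= s <= 1 ->
     sqnorm ((x + s *: (y - x)) - (x + t *: (y - x))) < rho ->
     (P (x + s *: (y - x)) <-> P (x + t *: (y - x)))) -> P x -> P y.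
Proof.
move=> loc Px.
pose sg (t : R) := x + t *: (y - x).
have loc' t : 0 <= t <= 1 -> exists2 del : R, 0 < del & forall s, 0 <= s <= 1 ->
    `|s - t| < del -> (P (sg s) <-> P (sg t)).
  move=> /loc [rho rho0 H].
  pose K := sqnorm (y - x) + 1 + rho.
  have n0 := sqnorm_ge0 (y - x).
  have K0 : 0 < K by rewrite /K; lra.
  exists (rho / K); first exact: divr_gt0.
  move=> s s01 st; apply: H => //.
  rewrite opprD addrACA subrr add0r -scalerBl sqnormZ.
  have r1 : rho / K < 1 by rewrite ltr_pdivrMr// mul1r /K; lra.
  have st1 : `|s - t| < 1 by exact: lt_trans r1.
  rewrite -real_normK ?num_real// expr2 -mulrA.
  apply: (@le_lt_trans _ _ (`|s - t| * sqnorm (y - x))).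
    by rewrite ler_wpM2l// ler_piMl// ltW.
  apply: (@le_lt_trans _ _ (rho / K * sqnorm (y - x))).
    by rewrite ler_wpM2r// ltW.
  rewrite mulrAC ltr_pdivrMr// ltr_pM2l// /K; lra.
pose I := `[0 : R, 1]%classic.
have in_I t : I t <-> 0 <= t <= 1 by rewrite /I /= in_itv.
pose O (S : R -> Prop) := [set s | exists t (del : R),
  [/\ 0 <= t <= 1, S t, `|s - t| < del &
   forall s', 0 <= s' <= 1 -> `|s' - t| < del -> (P (sg s') <-> P (sg t))]].
have oO S : open (O S).
  rewrite openE => s [t [del [t01 St st H]]].
  apply/nbhs_ballP; exists (del - `|s - t|); first by rewrite /= subr_gt0.
  move=> s' /=; rewrite -ball_normE /= => ss'; exists t, del; split=> //.
  apply: le_lt_trans (ler_distD s _ _) _.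
  by rewrite -ltrBrDr distrC.
have : I `&` [set t | P (sg t)] = I.
  apply: (@segment_connected R 0 1).
  - exists 0; split; first by apply/in_I; rewrite lexx ler01.
    by rewrite /= /sg scale0r addr0.
  - exists (O (fun t => P (sg t))); first exact: oO.
    apply/seteqP; split=> s [Is Ps]; (split; first by []).
      have [del del0 H] := loc' s (proj1 (in_I s) Is).
      exists s, del; split; [exact/in_I|exact: Ps|by rewrite subrr normr0|exact: H].
    by case: Ps => t [del [t01 Pt st H]]; apply/H => //; exact/in_I.
  - exists (~` O (fun t => ~ P (sg t))); first exact: open_closedC.
    apply/seteqP; split=> s [Is Ps]; (split; first by []).
      move=> [t [del [t01 Pt st H]]]; apply: Pt; apply/(H s) => //; exact/in_I.
    apply: contrapT => nP; apply: Ps.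
    have [del del0 H] := loc' s (proj1 (in_I s) Is).
    exists s, del; split; [exact/in_I|exact: nP|by rewrite subrr normr0|exact: H].
move=> E; have : I 1 by apply/in_I; rewrite lexx ler01.
by rewrite -E => -[_] /=; rewrite /sg scale1r addrC subrK.
Qed.

(** * Subspaces of the three-dimensional space *)

Definition cross u v : 'cV[R]_3 := \col_i
  [:: u i1 0 * v i2 0 - u i2 0 * v i1 0; u i2 0 * v i0 0 - u i0 0 * v i2 0;
      u i0 0 * v i1 0 - u i1 0 * v i0 0]`_i.

(** Cramer's rule in the basis formed by [u], [v] and their cross product. *)
Lemma cross_basis u v w : let n := cross u v in
  sqnorm n *: w = dot (cross w v) n *: u + dot (cross u w) n *: v + dot w n *: n.
Proof. by move=> n; apply: cV3P; rewrite !mxE /sqnorm !dot3 !mxE /=; ring. Qed.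

Lemma cross_eq0 u w : cross u w = 0 -> sqnorm u *: w = dot u w *: u.
Proof.
move=> /matrixP H; have := H i0 0; have := H i1 0; have := H i2 0; rewrite !mxE /= => h2 h1 h0.
apply: cV3P; rewrite !mxE /sqnorm !dot3; apply/eqP; rewrite -subr_eq0; apply/eqP.
- transitivity (u i2 0 * 0 - u i1 0 * 0 : R); last by ring.
  rewrite -{1}h1 -h2; ring.
- transitivity (u i0 0 * 0 - u i2 0 * 0 : R); last by ring.
  rewrite -{1}h2 -h0; ring.
- transitivity (u i1 0 * 0 - u i0 0 * 0 : R); last by ring.
  rewrite -{1}h0 -h1; ring.
Qed.

Lemma orthproj_line u : sqnorm u = 1 -> orthproj (u *m u^T).
Proof.
move=> u1; split; first by rewrite trmx_mul trmxK.
by rewrite mulmxA -(mulmxA u) dot_tr -/(sqnorm u) u1 mulmx1.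
Qed.

Lemma orthproj_compl Q : orthproj Q -> orthproj (1%:M - Q).
Proof.
move=> [Qt QQ]; split; first by rewrite linearB /= Qt trmx1.
by rewrite mulmxBl mul1mx mulmxBr mulmx1 QQ subrr subr0.
Qed.

Lemma mul_line u v : (u *m u^T) *m v = dot u v *: u.
Proof. by rewrite -mulmxA dot_tr mul_mx_scalar. Qed.

Lemma normalize u : u != 0 -> exists a u', [/\ a != 0, u' = a *: u & sqnorm u' = 1].
Proof.
move=> /sqnorm_gt0 u0; exists (Num.sqrt (sqnorm u))^-1, ((Num.sqrt (sqnorm u))^-1 *: u).
split=> //; first by rewrite invr_eq0 gt_eqF// sqrtr_gt0.
by rewrite sqnormZ exprVn sqr_sqrtr ?sqnorm_ge0// mulVf ?gt_eqF.
Qed.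

(** Independent vectors are added one at a time; the normal of the plane spanned
    by the first two is their cross product, so that [cross_basis] shows when
    they span [V] and when a third one is needed. *)
Lemma subspace_orthproj (V : 'cV[R]_3 -> Prop) :
  V 0 -> (forall a u v, V u -> V v -> V (a *: u + v)) ->
  exists2 Q, (forall v, V v <-> Q *m v = 0) &
    [\/ Q = 0, exists2 n, sqnorm n = 1 & Q = n *m n^T,
        exists2 l, sqnorm l = 1 & Q = 1%:M - l *m l^T | Q = 1%:M].
Proof.
move=> V0 Vlin.
have VZ a u : V u -> V (a *: u) by move=> Vu; rewrite -[_ *: u]addr0; exact: Vlin.
have [all0|] := pselect (forall v, V v -> v = 0).
  exists 1%:M; last exact: Or44.
  by move=> v; rewrite mul1mx; split=> [/all0|->].
move=> /existsNP [u /not_implyP [Vu /eqP /normalize [a [l [a0 lE l1]]]]].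
have Vl : V l by rewrite lE; exact: VZ.
have [line|] := pselect (forall v, V v -> v = dot l v *: l).
  exists (1%:M - l *m l^T); last by apply: Or43; exists l.
  move=> v; rewrite mulmxBl mul1mx mul_line; split.
    by move=> /line {1}->; rewrite subrr.
  by move=> /eqP; rewrite subr_eq0 => /eqP ->; exact: VZ.
move=> /existsNP [w /not_implyP [Vw wl]].
have n0 : cross l w != 0.
  by apply/eqP => /cross_eq0; rewrite l1 scale1r => /wl.
have [b [n [b0 nE n1]]] := normalize n0.
have inV v : dot v n = 0 -> V v.
  rewrite nE dotZr => /eqP; rewrite mulf_eq0 (negbTE b0) /= => /eqP vn.
  have := cross_basis l w v; rewrite /= vn scale0r addr0 => E.
  have s0 := sqnorm_gt0 n0.
  rewrite -[v](scalerK (a := sqnorm (cross l w))) ?gt_eqF// E.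
  by apply/VZ/Vlin => //; exact: VZ.
have [plane|] := pselect (forall v, V v -> dot v n = 0).
  exists (n *m n^T); last by apply: Or42; exists n.
  move=> v; rewrite mul_line; split.
    by move=> /plane; rewrite dotC => ->; rewrite scale0r.
  move=> /(congr1 (dot n)); rewrite dotZr -/(sqnorm n) n1 mulr1 dotC => vn; apply: inV.
  by rewrite vn /dot mulmx0 mxE.
move=> /existsNP [v3 /not_implyP [Vv3 /eqP v3n]].
exists 0; last exact: Or41.
move=> v; rewrite mul0mx; split=> // _.
have -> : v = (dot v n / dot v3 n) *: v3 + (v - (dot v n / dot v3 n) *: v3).
  by rewrite addrC subrK.
apply: Vlin => //; apply: inV.
by rewrite dotDl -scaleNr dotZl mulNr divfK// subrr.
Qed.

End Euclidean.

(** * Groups with an open orbit *)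

Lemma mulmx_cV_eq0 (R : realType) m n (M : 'M[R]_(m, n)) :
  (forall v : 'cV_n, M *m v = 0) -> M = 0.
Proof.
move=> H; apply/matrixP => i j.
by have := H (delta_mx j 0); rewrite -colE => /matrixP /(_ i 0); rewrite !mxE.
Qed.

(** The set [T] is meant to be the tangent space at the identity of a connected
    Lie subgroup [G]; all that is used of the Lie structure is the list of
    hypotheses below. *)
Section OpenOrbitGroups.
Variables (R : realType) (G T : set (conf_space R)).
Implicit Types (g h t : conf_space R) (u v w x y z : 'cV[R]_3).

Definition reach (H : set (conf_space R)) y z := exists2 g, H g & cact g y = z.

Hypothesis GS : conf_subgroup G.
Hypothesis Tlin : forall a t s, T t -> T s -> T (a *: t + s).
Hypothesis Ad : forall g t, G g -> T t -> exists2 t', T t' &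
  [/\ cscale t' = cscale t, clin t' = (clin g)^T *m clin t *m clin g &
   forall y, inf_act t' y = (cscale g)^-1 *: ((clin g)^T *m inf_act t (cact g y))].
Hypothesis const : forall m (P : 'M[R]_(m, 3)) y,
  (forall g t, G g -> T t -> P *m (clin g *m inf_act t y) = 0) ->
  forall g, G g -> P *m cact g y = P *m y.
Hypothesis tconst : forall m (P : 'M[R]_(m, 3)) y,
  (forall g, G g -> P *m cact g y = P *m y) -> forall t, T t -> P *m inf_act t y = 0.
Hypothesis Gopen : forall k (P : 'M[R]_(k, 3)) y,
  (forall z : 'cV[R]_k, exists2 t, T t & P *m inf_act t y = z) ->
  exists2 eta : R, 0 < eta & forall z : 'cV[R]_3, (forall i, `|z i 0 - y i 0| < eta) ->
    exists2 g, G g & P *m cact g y = P *m z.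
Hypothesis transl : forall p t,
  (forall e, 0 < e -> exists2 h, G h & cact h p = p /\ 0 < cscale h < e) ->
  T t -> T (cmk 0 0 (inf_act t p)).

Let GC g : G g -> Conf g. Proof. by case: GS => H _ _ _ /H. Qed.
Let GV g : G g -> G (cinv g). Proof. by case: GS => _ _ _; apply. Qed.
Let GM g h : G g -> G h -> G (cmul g h). Proof. by case: GS => _ _ H _; apply: H. Qed.
Let G1 : G (cone R). Proof. by case: GS. Qed.

Lemma reach_refl y : reach G y y.
Proof. by exists (cone R) => //; rewrite cact_one. Qed.

Lemma reach_sym y z : reach G y z -> reach G z y.
Proof.
by move=> [g Gg <-]; exists (cinv g); [exact: GV|rewrite (cactK (GC Gg))].
Qed.

Lemma reach_trans y z w : reach G y z -> reach G z w -> reach G y w.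
Proof.
move=> [g Gg <-] [h Gh <-].
by exists (cmul h g); [exact: GM|rewrite cact_cmul].
Qed.

Lemma cactB g x y : cact g x - cact g y = cscale g *: (clin g *m (x - y)).
Proof. by rewrite /cact opprD addrACA subrr addr0 -scalerBr -mulmxBr. Qed.

Lemma sqnorm_cactB g x y : Conf g ->
  sqnorm (cact g x - cact g y) = cscale g ^+ 2 * sqnorm (x - y).
Proof. by move=> Cg; rewrite cactB sqnormZ sqnorm_orth// conf_orth'. Qed.

(** Such a point has an open orbit, by [full_open]. *)
Definition full y := forall z, exists2 t, T t & inf_act t y = z.

Lemma Tscale a t : T t -> T (a *: t).
Proof.
move=> Tt; have T0 : T (0 : conf_space R).
  rewrite (_ : 0 = (-1) *: t + t :> conf_space R); first exact: Tlin.
  by rewrite scaleN1r addNr.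
by rewrite -[_ *: t]addr0; exact: Tlin.
Qed.

Lemma inf_act0 y : inf_act (0 : conf_space R) y = 0.
Proof.
by rewrite /inf_act [cscale _]/= [clin _]/= [ctrans _]/= scale0r mul0mx !addr0.
Qed.

Lemma inf_actZ a t y : inf_act (a *: t) y = a *: inf_act t y.
Proof. by rewrite -[a *: t]addr0 inf_act_linear inf_act0 addr0. Qed.

Lemma inf_actD t s y : inf_act (t + s) y = inf_act t y + inf_act s y.
Proof. by rewrite -[t]scale1r inf_act_linear !scale1r. Qed.

Lemma inf_act_transl v y : inf_act (cmk 0 0 v) y = v :> 'cV[R]_3.
Proof. by rewrite /inf_act [cscale _]/= [clin _]/= scale0r mul0mx !add0r. Qed.

Lemma inf_actB t y z :
  inf_act t y - inf_act t z = inf_act (cmk (cscale t) (clin t) 0) (y - z).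
Proof.
rewrite /inf_act [cscale (cmk _ _ _)]/= [clin (cmk _ _ _)]/=.
rewrite [ctrans (cmk _ _ _)]/= addr0.
by rewrite opprD addrACA subrr addr0 opprD addrACA -scalerBr -mulmxBr.
Qed.

Lemma coord_ball (eta : R) z y : sqnorm (z - y) < eta ^+ 2 -> 0 < eta ->
  forall i, `|z i 0 - y i 0| < eta.
Proof.
move=> zy eta0 i.
rewrite -(ltr_pXn2r (n := 2))// ?nnegrE ?(ltW eta0)// real_normK ?num_real//.
by apply: le_lt_trans zy; have := coord_le_sqnorm (z - y) i; rewrite !mxE.
Qed.

Lemma full_open y : full y -> exists2 eta : R, 0 < eta &
  forall z, sqnorm (z - y) < eta -> reach G y z.
Proof.
move=> fy; have [|eta eta0 H] := @Gopen 3 1%:M y.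
  by move=> z; have [t Tt tE] := fy z; exists t => //; rewrite mul1mx.
exists (eta ^+ 2); first exact: exprn_gt0.
move=> z zy; have [g Gg] := H z (coord_ball zy eta0).
by rewrite !mul1mx => gE; exists g.
Qed.

(** The open orbit contains balls of the same radius around all its points, so
    it is also closed. *)
Lemma isometric_transitive x : (forall g, G g -> cscale g = 1) -> full x ->
  forall y z, reach G y z.
Proof.
move=> iso fx.
have [eta eta0 H] := full_open fx.
have ball y z : reach G x y -> sqnorm (z - y) < eta -> reach G x z.
  move=> [g Gg <-] zy; have Cg := GC Gg.
  have [|h Gh hE] := H (cact (cinv g) z).
    have := sqnorm_cactB (cact (cinv g) z) x Cg.
    by rewrite (cactKV Cg) iso// expr1n mul1r => <-.
  by exists (cmul g h); [exact: GM|rewrite cact_cmul hE (cactKV Cg)].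
suff all y : reach G x y by move=> y z; apply: reach_trans (reach_sym (all y)) (all z).
apply: (@segment_ind _ (reach G x) x); last exact: reach_refl.
move=> t _; exists eta => // s _ st; split=> r; apply: ball r _ => //.
by rewrite -opprB sqnormN.
Qed.

Lemma translations_lin a u v :
  T (cmk 0 0 u) -> T (cmk 0 0 v) -> T (cmk 0 0 (a *: u + v)).
Proof.
move=> Vu Vv.
have E : a *: cmk 0 0 u + cmk 0 0 v = cmk 0 0 (a *: u + v) :> conf_space R.
  apply: conf_eqP => [|i j|//]; first by rewrite -[LHS]/(a * 0 + 0) mulr0 addr0.
  by rewrite -[LHS]/((a *: (0 : 'M[R]_3) + 0) i j) scaler0 addr0.
by rewrite -E; exact: Tlin.
Qed.

Section Contracting.
Variables (p x : 'cV[R]_3).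
Hypothesis fx : full x.
Hypothesis pos : forall g, G g -> 0 < cscale g.
Hypothesis contr : forall e, 0 < e -> exists2 h, G h & cact h p = p /\ 0 < cscale h < e.

Let V v := T (cmk 0 0 v).

Let V_stable g v : G g -> V v -> V ((clin g)^T *m v).
Proof.
move=> Gg Vv; have [t' Tt' [s' l' i']] := Ad Gg Vv.
suff E : cscale g *: t' = cmk 0 0 ((clin g)^T *m v).
  by rewrite /V -E; exact: Tscale.
have t'0 : inf_act t' 0 = ctrans t' by rewrite /inf_act scaler0 mulmx0 !add0r.
rewrite [cscale (cmk _ _ _)]/= in s'; rewrite [clin (cmk _ _ _)]/= mulmx0 mul0mx in l'.
have := i' 0; rewrite t'0 inf_act_transl => E.
apply: conf_eqP.
- by rewrite -[cscale (_ *: _)]/(cscale g * cscale t') s' mulr0.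
- by move=> i j; rewrite -[clin (_ *: _)]/(cscale g *: clin t') l' scaler0.
- move=> i; rewrite -[ctrans (_ *: _)]/(cscale g *: ctrans t') E.
  rewrite scalerA mulfV ?scale1r//.
  by rewrite gt_eqF// pos.
Qed.

Let V_stable' g v : G g -> V v -> V (clin g *m v).
Proof.
by move=> Gg /(V_stable (GV Gg)); rewrite [clin (cinv _)]/= trmxK.
Qed.

Variable Q : 'M[R]_3.
Hypothesis Qp : orthproj Q.
Hypothesis VQ : forall v, V v <-> Q *m v = 0.

Let QQ v : Q *m (Q *m v) = Q *m v. Proof. by case: Qp => _ QQ; rewrite mulmxA QQ. Qed.

Let V_compl v : V (v - Q *m v). Proof. by apply/VQ; rewrite mulmxBr QQ subrr. Qed.

(** Both [clin g] and its transpose preserve [V], hence so does [clin g] its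
    orthogonal complement. *)
Let Q_comm g v : G g -> Q *m (clin g *m v) = clin g *m (Q *m v).
Proof.
move=> Gg; case: Qp => Qt QQm.
have e0 (B : 'M[R]_3) : (forall v, V v -> V (B *m v)) -> Q *m B = Q *m B *m Q.
  move=> VB; apply/eqP; rewrite -subr_eq0; apply/eqP/mulmx_cV_eq0 => w.
  by rewrite mulmxBl -!mulmxA -!mulmxBr; apply/VQ/VB.
have e1 := e0 _ (fun w => @V_stable' g w Gg).
have e2 := e0 _ (fun w => @V_stable g w Gg).
have /(congr1 trmx) := e2; rewrite !trmx_mul trmxK Qt => e3.
by rewrite !mulmxA e1 -(mulmxA Q) -e3.
Qed.

(** The velocities at [p] all lie in [V], which the linear parts preserve. *)
Let fix_p g : G g -> Q *m cact g p = Q *m p.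
Proof.
apply: const => h t Gh Tt; rewrite Q_comm//.
have /VQ -> : V (inf_act t p) by exact: transl.
by rewrite mulmx0.
Qed.

Lemma cact_proj g y :
  G g -> Q *m (cact g y - p) = cscale g *: (clin g *m (Q *m (y - p))).
Proof.
move=> Gg; have -> : cact g y - p = (cact g y - cact g p) + (cact g p - p).
  by rewrite addrA subrK.
rewrite mulmxDr cactB -scalemxAr (Q_comm _ Gg).
by rewrite [X in _ + X]mulmxBr fix_p// subrr addr0.
Qed.

Let velocity_in t y : T t -> Q *m (y - p) = 0 -> Q *m inf_act t y = 0.
Proof.
move=> Tt y0; apply: tconst Tt => g Gg.
have := cact_proj y Gg; rewrite y0 mulmx0 scaler0 => /eqP.
rewrite mulmxBr subr_eq0 => /eqP ->.
by move/eqP: y0; rewrite mulmxBr subr_eq0 => /eqP.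
Qed.

(** The velocity of [t] is affine in the position, and by [velocity_in] its
    linear part preserves [V]. *)
Let velocity t y z r : T t -> Q *m (z - p) = r *: (Q *m (y - p)) ->
  Q *m inf_act t z = r *: (Q *m inf_act t y).
Proof.
move=> Tt zy; pose lin := inf_act (cmk (cscale t) (clin t) 0).
have linE w : lin w = cscale t *: w + clin t *m w.
  rewrite /lin /inf_act [cscale (cmk _ _ _)]/= [clin (cmk _ _ _)]/=.
  by rewrite [ctrans (cmk _ _ _)]/= addr0.
have linB w w' : lin (w - w') = lin w - lin w'.
  by rewrite !linE scalerBr mulmxBr opprD addrACA.
have linZ a w : lin (a *: w) = a *: lin w.
  by rewrite !linE scalerDr -scalemxAr !scalerA mulrC.
have at_p : Q *m inf_act t p = 0 by apply/VQ; exact: transl.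
have Qlin w : Q *m lin w = Q *m inf_act t (p + w).
  have e w' : p + w' - p = w' by rewrite addrC addKr.
  by rewrite /lin -[w in LHS]e -inf_actB mulmxBr at_p subr0.
have lin0 w : Q *m w = 0 -> Q *m lin w = 0.
  by move=> w0; rewrite Qlin velocity_in// [p + w]addrC addrK.
have -> : inf_act t z = inf_act t (p + (z - p)) by rewrite addrC subrK.
have -> : inf_act t y = inf_act t (p + (y - p)).
  by rewrite [in RHS]addrC subrK.
have h : lin (z - p) - r *: lin (y - p) = lin (z - p - r *: (y - p)).
  by rewrite -linZ -linB.
rewrite -(Qlin (z - p)) -(Qlin (y - p)) (scalemxAr r Q).
apply/subr0_eq; rewrite -(mulmxBr Q) h; apply: lin0.
by rewrite mulmxBr -scalemxAr zy subrr.
Qed.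

Let full_scale y z r :
  r != 0 -> Q *m (z - p) = r *: (Q *m (y - p)) -> full y -> full z.
Proof.
move=> r0 zy fy w; have [t Tt tE] := fy (r^-1 *: w).
have Qt : Q *m inf_act t z = Q *m w.
  by rewrite (velocity Tt zy) tE -scalemxAr scalerA mulfV// scale1r.
pose v := w - inf_act t z.
have Vv : V v by apply/VQ; rewrite mulmxBr Qt subrr.
exists (t + cmk 0 0 v); first by rewrite -[t]scale1r; exact: Tlin.
by rewrite inf_actD inf_act_transl /v addrC subrK.
Qed.

Let full_act y g : G g -> full y -> full (cact g y).
Proof.
move=> Gg fy w; have Cg := GC Gg.
have [t Tt tE] := fy (cscale g *: ((clin g)^T *m w)).
have [t' Tt' [_ _ i']] := Ad (GV Gg) Tt.
exists ((cscale g)^-1 *: ((cscale g)^-1 *: t')); first by do 2!apply: Tscale.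
have b0 := conf_scale_neq0 Cg.
rewrite !inf_actZ i' (cactK Cg) tE [cscale (cinv _)]/= [clin (cinv _)]/=.
rewrite trmxK invrK.
rewrite -scalemxAr mulmxA conf_orth// mul1mx !scalerA.
have -> : (cscale g)^-1 / cscale g * cscale g * cscale g = 1 by field.
by rewrite scale1r.
Qed.

(** By [velocity] these points have an open orbit too.  Negative values of [r]
    make them cover both sides of [p + V] when it is a plane. *)
Let cone_pts z := exists g r,
  [/\ G g, r != 0 & Q *m (z - p) = r *: (Q *m (cact g x - p))].

Let cone_full z : cone_pts z -> full z.
Proof.
by move=> [g [r [Gg r0 E]]]; apply: full_scale E _ => //; exact: full_act.
Qed.

(** An element of [G] and a scaling carry a ball around [x] to a ball whose radius
    is proportional to the distance from its centre to [p + V]. *)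
Let cone_uniform : Q *m (x - p) != 0 ->
  exists2 kap : R, 0 < kap & forall y z, cone_pts y ->
  sqnorm (Q *m (z - y)) < kap * sqnorm (Q *m (y - p)) -> cone_pts z.
Proof.
move=> Qx; have [eta eta0 H] := full_open fx.
have q0 := sqnorm_gt0 Qx.
exists (eta / sqnorm (Q *m (x - p))); first exact: divr_gt0.
move=> y z [g [r [Gg r0 yE]]]; have Cg := GC Gg; have b0 := conf_scale_neq0 Cg.
rewrite yE sqnormZ (cact_proj _ Gg) sqnormZ (sqnorm_orth _ (conf_orth' Cg)) => zy.
pose z' := cact g x + r^-1 *: (Q *m (z - y)).
have [|h Gh hE] := H (cact (cinv g) z').
  have := sqnorm_cactB (cact (cinv g) z') x Cg.
  rewrite (cactKV Cg) /z' addrC addKr sqnormZ => E.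
  have s0 : 0 < r ^+ 2 * cscale g ^+ 2 by rewrite mulr_gt0// exprn_even_gt0.
  have : r ^+ 2 * cscale g ^+ 2 * sqnorm (cact (cinv g) z' - x) <
      r ^+ 2 * cscale g ^+ 2 * eta.
    rewrite -mulrA -E mulrA -exprMn mulfV// expr1n mul1r.
    suff <- : eta / sqnorm (Q *m (x - p)) *
      (r ^+ 2 * (cscale g ^+ 2 * sqnorm (Q *m (x - p)))) =
      r ^+ 2 * cscale g ^+ 2 * eta by [].
    by field; rewrite gt_eqF.
  by rewrite ltr_pM2l.
exists (cmul g h), r; split=> //; first exact: GM.
rewrite cact_cmul hE (cactKV Cg).
have -> : z' - p = (cact g x - p) + r^-1 *: (Q *m (z - y)).
  by rewrite /z' addrAC.
rewrite (mulmxDr Q (cact g x - p)) scalerDr -yE -scalemxAr scalerA mulfV//.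
rewrite scale1r.
by rewrite QQ -mulmxDr [y - p + _]addrC addrA subrK.
Qed.

(** By [cone_uniform] a segment from [x] that avoids [p + V] stays in [cone_pts];
    one that meets [p + V] ends at a negative multiple of [x], modulo [V] and
    with origin [p]. *)
Let full_outside y : Q *m (y - p) != 0 -> full y.
Proof.
move=> Qy; apply: cone_full.
have Qx : Q *m (x - p) != 0.
  apply: contra Qy => /eqP Qx; rewrite (_ : Q = 0) ?mul0mx//.
  apply: mulmx_cV_eq0 => w; have [t Tt <-] := fx w; exact: velocity_in.
have [hit|avoid] := pselect
  (exists2 t : R, 0 <= t <= 1 & Q *m (x + t *: (y - x) - p) = 0).
  have [t /andP[t0 t1]] := hit.
  have -> : x + t *: (y - x) - p = (1 - t) *: (x - p) + t *: (y - p).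
    by apply/matrixP => i j; rewrite !mxE; ring.
  rewrite mulmxDr -!scalemxAr => E.
  have tn0 : t != 0.
    apply: contra Qx => /eqP tE; move: E.
    by rewrite tE subr0 scale1r scale0r addr0 => ->.
  have tn1 : 1 - t != 0.
    apply: contra Qy => /eqP tE; move: E; rewrite tE scale0r add0r => /eqP.
    by rewrite scaler_eq0 (negbTE tn0).
  exists (cone R), (- (t^-1 * (1 - t))); split=> //.
    by rewrite oppr_eq0 mulf_neq0// invr_eq0.
  rewrite cact_one scaleNr -scalerA; apply/eqP; rewrite -addr_eq0 addrC.
  by rewrite -[X in _ + X](scalerK tn0) -scalerDr E scaler0.
have [kap kap0 H] := cone_uniform Qx.
apply: (@segment_ind _ cone_pts x); last first.
  by exists (cone R), 1; rewrite cact_one scale1r oner_neq0.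
move=> t t01; set w := x + t *: (y - x).
have w0 : 0 < sqnorm (Q *m (w - p)).
  by apply/sqnorm_gt0/eqP => E; apply: avoid; exists t.
(* so close to [w], the distance to [p + V] is at least half of that of [w]:
   [cone_uniform] then applies both from [w] and to [w] *)
pose mk := Num.min kap 1.
have mk0 : 0 < mk by rewrite lt_min kap0 ltr01.
exists (mk * (sqnorm (Q *m (w - p)) / 4)); first by rewrite mulr_gt0// divr_gt0.
move=> s s01; set w' := x + s *: (y - x) => ww'.
have d_le : sqnorm (Q *m (w' - w)) <= sqnorm (w' - w) by exact: sqnorm_proj_le.
have mk1 : mk <= 1 by rewrite ge_min lexx orbT.
have mkk : mk <= kap by rewrite ge_min lexx.
have l1 : sqnorm (Q *m (w' - w)) < kap * (sqnorm (Q *m (w - p)) / 4).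
  apply: le_lt_trans d_le (lt_le_trans ww' _); rewrite ler_wpM2r//.
  by rewrite ltW// divr_gt0.
have l2 : sqnorm (Q *m (w' - w)) < sqnorm (Q *m (w - p)) / 4.
  apply: le_lt_trans d_le (lt_le_trans ww' _); rewrite ler_piMl//.
  by rewrite ltW// divr_gt0.
split=> Ew; last first.
  apply: H Ew _; apply: lt_le_trans l1 _.
  by rewrite ler_wpM2l// ?(ltW kap0)//; lra.
have sym : sqnorm (Q *m (w - w')) = sqnorm (Q *m (w' - w)).
  by rewrite -sqnormN -mulmxN opprB.
apply: H Ew _; rewrite sym; apply: lt_le_trans l1 _; rewrite ler_wpM2l// ?(ltW kap0)//.
have := sqnormD_le (Q *m (w' - p)) (Q *m (w - w')).
rewrite -mulmxDr [w' - p + _]addrC addrA subrK sym; lra.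
Qed.

Lemma reach_segment y z :
  (forall t : R, 0 <= t <= 1 -> Q *m (y + t *: (z - y) - p) != 0) ->
  reach G y z.
Proof.
move=> avoid; apply: (@segment_ind _ (reach G y) y); last exact: reach_refl.
move=> t t01; have [eta eta0 H] := full_open (full_outside (avoid t t01)).
exists eta => // s _ /H ts; split=> r; last exact: reach_trans ts.
by apply: reach_trans r _; exact: reach_sym.
Qed.

(** The translations in [T] are velocities that span [V] at each point, and the
    orbit of [y] does not leave [p + V]. *)
Let flat_open y : Q *m (y - p) = 0 -> exists2 eta : R, 0 < eta &
  forall z, Q *m (z - p) = 0 -> sqnorm (z - y) < eta -> reach G y z.
Proof.
(* the matrix [P] restricts to linear coordinates on [V] *)
move=> Qy; pose P := row_base (1%:M - Q).
have [z|eta eta0 H] := @Gopen _ P y.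
  pose u := pinvmx P *m z.
  have PQ : P *m Q = 0.
    have /submxP [Y ->] : (P <= 1%:M - Q)%MS by rewrite eq_row_base.
    by case: Qp => _ q2; rewrite -mulmxA mulmxBl mul1mx q2 subrr mulmx0.
  exists (cmk 0 0 (u - Q *m u)); first exact: V_compl.
  rewrite inf_act_transl mulmxBr (mulmxA P Q u) PQ mul0mx subr0 /u mulmxA.
  rewrite mulmxVp ?mul1mx//.
  exact: row_base_free.
exists (eta ^+ 2); first exact: exprn_gt0.
move=> z Qz zy; have [g Gg gE] := H z (coord_ball zy eta0).
exists g => //; apply/subr0_eq; set dl := _ - z.
have Qd : Q *m dl = 0.
  rewrite /dl (_ : _ - z = (cact g y - p) - (z - p)); last first.
    by rewrite opprB addrA subrK.
  by rewrite mulmxBr cact_proj// Qy Qz mulmx0 scaler0 subrr.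
have /submxP [X XE] : (1%:M - Q <= P)%MS by rewrite eq_row_base.
have : (1%:M - Q) *m dl = 0 by rewrite XE -mulmxA mulmxBr gE subrr mulmx0.
by rewrite mulmxBl mul1mx Qd subr0.
Qed.

Lemma reach_flat y z : Q *m (y - p) = 0 -> Q *m (z - p) = 0 -> reach G y z.
Proof.
move=> Qy Qz; apply: (@segment_ind _ (reach G y) y); last exact: reach_refl.
have Qs (t : R) : Q *m (y + t *: (z - y) - p) = 0.
  have -> : y + t *: (z - y) - p = (1 - t) *: (y - p) + t *: (z - p).
    by apply/matrixP => i j; rewrite !mxE; ring.
  by rewrite mulmxDr -!scalemxAr Qy Qz !scaler0 addr0.
move=> t t01; have [eta eta0 H] := flat_open (Qs t).
exists eta => // s _ /(H _ (Qs s)) ts; split=> r; last exact: reach_trans ts.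
by apply: reach_trans r _; exact: reach_sym.
Qed.

End Contracting.

(** A similarity of ratio other than 1 has a fixed point, and its powers with
    exponents of one sign are arbitrarily strong contractions. *)
Lemma contraction_center g : G g -> (forall h, G h -> 0 < cscale h) -> cscale g != 1 ->
  exists p, forall e, 0 < e -> exists2 h, G h & cact h p = p /\ 0 < cscale h < e.
Proof.
move=> Gg pos g1.
wlog gl1 : g Gg g1 / cscale g < 1.
  move=> wl; have := g1; rewrite neq_lt => /orP[lt1|gt1]; first exact: wl Gg g1 lt1.
  apply: (wl (cinv g)); [exact: GV| |].
    by rewrite [cscale (cinv _)]/= invr_eq1.
  by rewrite [cscale (cinv _)]/= invf_lt1// pos.
have Cg := GC Gg; have g0 := pos _ Gg.
pose N := 1%:M - cscale g *: clin g.
have Nu : N \in unitmx.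
  rewrite -unitmx_tr -row_free_unit; apply: inj_row_free => v vN.
  have : N *m v^T = 0 by apply: trmx_inj; rewrite trmx_mul trmxK vN trmx0.
  rewrite mulmxBl mul1mx -scalemxAl => /eqP; rewrite subr_eq0 => /eqP E.
  have E2 : sqnorm v^T = cscale g ^+ 2 * sqnorm v^T.
    by rewrite {1}E sqnormZ sqnorm_orth// conf_orth'.
  apply: trmx_inj; rewrite trmx0; apply: sqnorm_eq0.
  have : (1 - cscale g ^+ 2) * sqnorm v^T = 0 by rewrite mulrBl mul1r -E2 subrr.
  move/eqP; rewrite mulf_eq0 => /orP[/eqP h|/eqP //].
  have : cscale g ^+ 2 < 1 by rewrite expr_lt1// ltW.
  by move: h => /eqP; rewrite subr_eq0 => /eqP <-; rewrite ltxx.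
pose p := invmx N *m ctrans g.
have gp : cact g p = p.
  have : N *m p = ctrans g by rewrite /p mulmxA mulmxV// mul1mx.
  by rewrite mulmxBl mul1mx -scalemxAl /cact => <-; rewrite addrC subrK.
exists p => e e0.
have pw n : exists2 h, G h & cact h p = p /\ cscale h = cscale g ^+ n.
  elim: n => [|n [h Gh [hp hs]]]; first by exists (cone R); rewrite ?cact_one ?expr0.
  exists (cmul g h); first exact: GM.
  rewrite cact_cmul hp gp -[cscale (cmul g h)]/(cscale g * cscale h).
  by rewrite hs exprS.
have /cvgrPdist_lt /(_ e e0) : (fun n => cscale g ^+ n) @ \oo --> (0 : R).
  by apply: cvg_expr; rewrite gtr0_norm.
move=> [n _ /(_ n (leqnn n))]; rewrite sub0r normrN => ne.
have [h Gh [hp hs]] := pw n; exists h => //; split=> //.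
by rewrite pos//= hs; apply: le_lt_trans ne; exact: ler_norm.
Qed.

(** When the scale factors are all 1 the group is transitive, which is the case
    [Q = 0]; otherwise [p] is the centre of a contraction and [Q] projects onto
    the orthogonal complement of the space of translations in [T]. *)
Lemma orbit_structure x : full x -> (forall g, G g -> 0 < cscale g) ->
  exists p, exists2 Q : 'M[R]_3,
    [\/ Q = 0, exists2 n, sqnorm n = 1 & Q = n *m n^T,
        exists2 l, sqnorm l = 1 & Q = 1%:M - l *m l^T | Q = 1%:M] &
  [/\ forall y z, Q *m (y - p) = 0 -> Q *m (z - p) = 0 -> reach G y z,
      forall y z, (forall t : R, 0 <= t <= 1 -> Q *m (y + t *: (z - y) - p) != 0) ->
        reach G y z &
      forall g y, G g ->
        Q *m (cact g y - p) = cscale g *: (clin g *m (Q *m (y - p)))].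
Proof.
move=> fx pos.
have [iso|] := pselect (forall g, G g -> cscale g = 1).
  exists 0; exists 0; first exact: Or41.
  split=> [y z _ _|y z _|g y _]; try exact: (isometric_transitive iso fx).
  by rewrite !mul0mx mulmx0 scaler0.
move=> /existsNP [g /not_implyP [Gg /eqP g1]].
have [p contr] := contraction_center Gg pos g1.
have [|a u v Vu Vv|Q QV Qcases] :=
  @subspace_orthproj R (fun v => T (cmk 0 0 v)).
- have [t Tt tE] := fx 0; have := Tscale 0 Tt; rewrite scale0r; congr T.
- exact: translations_lin.
have Qp : orthproj Q.
  case: Qcases => [->|[n n1 ->]|[l l1 ->]|->].
  - by split; rewrite ?trmx0 ?mul0mx.
  - exact: orthproj_line.
  - exact/orthproj_compl/orthproj_line.
  - by split; rewrite ?trmx1 ?mul1mx.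
exists p; exists Q => //; split.
- move=> y z; exact: (reach_flat pos contr Qp QV).
- move=> y z; exact: (reach_segment fx pos contr Qp QV).
- move=> h y; exact: (cact_proj pos contr Qp QV).
Qed.
End OpenOrbitGroups.

(** * Comparison with subgroups given by generators *)

Section Models.
Variable R : realType.
Implicit Types (g h : conf_space R) (u v w x y z p : 'cV[R]_3) (C Q : 'M[R]_3).

Lemma same_orbits_of_reach c (G H : set (conf_space R)) : Conf c ->
  (forall y z, reach G y z <-> reach H (cact c y) (cact c z)) ->
  same_orbits_up_to_conj G H.
Proof.
move=> Cc GH; exists c => //; rewrite /orbits; congr (_ @` _); apply/funext => x.
apply/seteqP; split=> z.
  move=> [_ [g Gg <-] <-].
  have : reach G (cact (cinv c) x) (cact g (cact (cinv c) x)) by exists g.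
  by move=> /GH; rewrite (cactKV Cc) !cact_cmul => -[h Hh hE]; exists h.
move=> [h Hh hE].
have : reach G (cact (cinv c) x) (cact (cinv c) z).
  by apply/GH; rewrite !(cactKV Cc); exists h.
move=> [g Gg gE]; exists (cmul (cmul c g) (cinv c)); first by exists g.
by rewrite !cact_cmul gE (cactKV Cc).
Qed.

Lemma Conf_subgroup : conf_subgroup (@Conf R).
Proof.
split=> //; [exact: Conf_cone|exact: Conf_cmul|exact: Conf_cinv].
Qed.

Lemma conf_gen_subgroup (X : set (conf_space R)) :
  X `<=` @Conf R -> conf_subgroup (conf_gen X).
Proof.
move=> XC; split.
- by move=> g; apply; split=> //; exact: Conf_subgroup.
- by move=> K [[]].
- move=> g h Hg Hh K XK; case: (XK) => -[_ _ KM _] _.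
  by apply: KM; [exact: Hg|exact: Hh].
- by move=> g Hg K XK; case: (XK) => -[_ _ _ KV] _; apply: KV; exact: Hg.
Qed.

Lemma conf_gen_reach (X : set (conf_space R)) y z :
  reach X y z -> reach (conf_gen X) y z.
Proof. by move=> [g Xg <-]; exists g => // K [_ XK]; exact: XK. Qed.

(** The conformal maps that respect [J] form a subgroup. *)
Lemma conf_gen_invariant (X : set (conf_space R)) (J : 'cV[R]_3 -> Prop) :
  X `<=` @Conf R -> (forall g y, X g -> J (cact g y) <-> J y) ->
  forall y z, reach (conf_gen X) y z -> J z <-> J y.
Proof.
move=> XC XJ y z [g Hg <-].
have [_] : [set g | Conf g /\ forall y, J (cact g y) <-> J y] g; last exact.
apply: Hg; split; last by move=> h Xh; split=> [|w]; [exact: XC|exact: XJ].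
split.
- by move=> h [].
- by split=> [|w]; [exact: Conf_cone|rewrite cact_one].
- move=> h k [Ch Jh] [Ck Jk]; split=> [|w]; first exact: Conf_cmul.
  by rewrite cact_cmul; exact: iff_trans (Jh _) (Jk _).
- move=> h [Ch Jh]; split=> [|w]; first exact: Conf_cinv.
  by have := Jh (cact (cinv h) w); rewrite (cactKV Ch) => ->.
Qed.

Lemma cact_trans v y : cact (cmk 1 1%:M v) y = y + v.
Proof.
by rewrite /cact [cscale _]/= [clin _]/= [ctrans _]/= scale1r mul1mx.
Qed.

Lemma cact_dil a y : cact (cmk a 1%:M 0) y = a *: y.
Proof. by rewrite /cact [cscale _]/= [clin _]/= [ctrans _]/= mul1mx addr0. Qed.

Lemma cact_lin C y : cact (cmk 1 C 0) y = C *m y.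
Proof. by rewrite /cact [cscale _]/= [clin _]/= [ctrans _]/= scale1r addr0. Qed.

Lemma Conf_trans v : Conf (cmk 1 1%:M v).
Proof.
by split; rewrite ?[cscale _]/= ?[clin _]/= ?oner_neq0// trmx1 mulmx1.
Qed.

Lemma Conf_lin C v : C *m C^T = 1%:M -> Conf (cmk 1 C v).
Proof. by split; rewrite ?[cscale _]/= ?[clin _]/= ?oner_neq0. Qed.

Lemma Rpos_sub_Conf : Rpos_grp R `<=` @Conf R.
Proof.
move=> _ [a a0 ->]; split; first by rewrite [cscale _]/= gt_eqF.
by rewrite [clin _]/= trmx1 mulmx1.
Qed.

Lemma reach_Rpos a y : 0 < a -> reach (Rpos_grp R) y (a *: y).
Proof. by move=> a0; exists (cmk a 1%:M 0); [exists a|rewrite cact_dil]. Qed.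

Lemma inord_i : (inord 0 = i0) * (inord 1 = i1) * (inord 2 = i2).
Proof. by split; first split; apply: val_inj; rewrite /= inordK. Qed.

(** When [u] and [v] differ, the reflection that exchanges them. *)
Lemma householder u v : sqnorm u = 1 -> sqnorm v = 1 ->
  exists2 C : 'M[R]_3, C *m C^T = 1%:M & C *m u = v.
Proof.
move=> u1 v1; have [->|uv] := eqVneq u v.
  by exists 1%:M; rewrite ?trmx1 ?mulmx1 ?mul1mx.
pose w := u - v; have w0 : 0 < sqnorm w by rewrite sqnorm_gt0// subr_eq0.
have [k [k0 kE]] : exists k, k != 0 /\ k = sqnorm w by exists (sqnorm w); rewrite gt_eqF.
have ww : w^T *m w = k%:M by rewrite dot_tr kE.
pose C := 1%:M - (2 / k) *: (w *m w^T).
have Ct : C^T = C by rewrite /C linearB /= linearZ /= trmx1 trmx_mul trmxK.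
have wv : dot w u = k / 2.
  have : k = 2 - 2 * dot u v.
    rewrite kE /sqnorm /w -scaleN1r !dotDl !dotDr !dotZl !dotZr (dotC v u).
    by rewrite -/(sqnorm u) -/(sqnorm v) u1 v1; ring.
  move=> ->; rewrite /w -scaleN1r dotDl dotZl -/(sqnorm u) u1 (dotC v u); lra.
exists C.
  have MM : w *m w^T *m (w *m w^T) = k *: (w *m w^T).
    by rewrite mulmxA -(mulmxA w) ww mul_mx_scalar scalemxAl.
  rewrite Ct /C; move: (w *m w^T) MM => M MM.
  rewrite mulmxBl mul1mx mulmxBr mulmx1 -scalemxAl -scalemxAr MM.
  by apply/matrixP => i j; rewrite !mxE; field.
rewrite /C mulmxBl mul1mx -scalemxAl mul_line wv scalerA (_ : _ * _ = 1); last by field.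
by rewrite scale1r /w opprB addrC subrK.
Qed.

Lemma exists_angle (c s : R) :
  c ^+ 2 + s ^+ 2 = 1 -> exists t, cos t = c /\ sin t = s.
Proof.
move=> cs.
have c1 : -1 <= c <= 1.
  have := sqr_ge0 s; have := sqr_ge0 c => c2 s2.
  rewrite -ler_norml -(ler_pXn2r (n := 2))// ?nnegrE// real_normK ?num_real//.
  by rewrite expr1n; lra.
have sE : Num.sqrt (1 - c ^+ 2) = `|s| by rewrite -cs addrAC subrr add0r sqrtr_sqr.
have [s0|s0] := leP 0 s.
  by exists (acos c); rewrite acosK// sin_acos// sE ger0_norm.
by exists (- acos c); rewrite cosN sinN acosK// sin_acos// sE ltr0_norm// opprK.
Qed.

End Models.

(** * Orbits of the model groups *)

Section ModelOrbits.
Variable R : realType.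
Implicit Types (g h : conf_space R) (u v w x y z p : 'cV[R]_3) (C Q : 'M[R]_3).

Lemma reach_trans_grp y z : reach (trans_grp R) y z.
Proof.
by exists (cmk 1 1%:M (z - y)); [exists (z - y)|rewrite cact_trans addrC subrK].
Qed.

Definition same_sign (a b : R) :=
  [\/ 0 < a /\ 0 < b, a < 0 /\ b < 0 | a = 0 /\ b = 0].

Lemma e_coord (i j : 'I_3) : e_ R i j 0 = (j == i)%:R.
Proof. by rewrite mxE eqxx andbT. Qed.

Lemma P_grp_sub_Conf : P_grp R `<=` @Conf R.
Proof. by move=> _ [a [b ->]]; exact: Conf_trans. Qed.

Lemma L_grp_sub_Conf : L_grp R `<=` @Conf R.
Proof. by move=> _ [a ->]; exact: Conf_trans. Qed.

Lemma SO3_grp_sub_Conf : SO3_grp R `<=` @Conf R.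
Proof. by move=> _ [M [MM _ ->]]; exact: Conf_lin. Qed.

Lemma Rot_mul t y : let z := Rot t *m y in
  [/\ z i0 0 = cos t * y i0 0 + sin t * y i1 0,
      z i1 0 = - sin t * y i0 0 + cos t * y i1 0 & z i2 0 = y i2 0].
Proof. by split; rewrite mxE sum3 !mxE /=; ring. Qed.

Lemma SO2_grp_sub_Conf : SO2_grp R `<=` @Conf R.
Proof.
move=> _ [t ->]; apply: Conf_lin; have := cos2Dsin2 t => cs.
apply/matrixP => i j; rewrite [LHS]mxE sum3 !mxE.
move: i j; apply: ord3P; apply: ord3P; rewrite /=; try ring;
  by rewrite -[RHS]cs; ring.
Qed.

Lemma SO2_sub_Conf : Rpos_grp R `|` SO2_grp R `|` L_grp R `<=` @Conf R.
Proof.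
by move=> g [[/Rpos_sub_Conf|/SO2_grp_sub_Conf]|/L_grp_sub_Conf].
Qed.

Lemma P_sub_Conf : Rpos_grp R `|` P_grp R `<=` @Conf R.
Proof. by move=> g [/Rpos_sub_Conf|/P_grp_sub_Conf]. Qed.

Lemma SO3_sub_Conf : Rpos_grp R `|` SO3_grp R `<=` @Conf R.
Proof. by move=> g [/Rpos_sub_Conf|/SO3_grp_sub_Conf]. Qed.

Lemma reach_mono (X Y : set (conf_space R)) y z :
  X `<=` Y -> reach X y z -> reach Y y z.
Proof. by move=> XY [g /XY Yg <-]; exists g. Qed.

Lemma reach_P y v : v i2 0 = 0 -> reach (P_grp R) y (y + v).
Proof.
move=> v2; exists (cmk 1 1%:M v); last by rewrite cact_trans.
exists (v i0 0), (v i1 0); congr cmk; apply: cV3P; rewrite !mxE !inord_i /= ?v2; ring.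
Qed.

Lemma reach_L y v : v i0 0 = 0 -> v i1 0 = 0 -> reach (L_grp R) y (y + v).
Proof.
move=> v0 v1; exists (cmk 1 1%:M v); last by rewrite cact_trans.
exists (v i2 0); congr cmk; apply: cV3P; rewrite !mxE !inord_i /= ?v0 ?v1; ring.
Qed.

Lemma orbits_halfspace y z : reach (conf_gen (Rpos_grp R `|` P_grp R)) y z <->
  same_sign (y i2 0) (z i2 0).
Proof.
have HG := conf_gen_subgroup P_sub_Conf; split.
  move=> r.
  have act g w : (Rpos_grp R `|` P_grp R) g ->
      exists2 a, 0 < a & cact g w i2 0 = a * w i2 0.
    move=> [[a a0 ->]|[a [b ->]]].
      by exists a => //; rewrite cact_dil mxE.
    by exists 1 => //; rewrite cact_trans !mxE !inord_i /=; ring.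
  have inv (J : 'cV[R]_3 -> Prop) :
      (forall w w' a, 0 < a -> w' i2 0 = a * w i2 0 -> J w' <-> J w) ->
      J z <-> J y.
    move=> HJ; apply: (conf_gen_invariant P_sub_Conf _ r) => g w /(act g w) [a a0 E].
    exact: HJ a0 E.
  have pos : 0 < z i2 0 <-> 0 < y i2 0.
    by apply: (inv (fun w => 0 < w i2 0)) => w w' a a0 ->; rewrite pmulr_rgt0.
  have neg : z i2 0 < 0 <-> y i2 0 < 0.
    by apply: (inv (fun w => w i2 0 < 0)) => w w' a a0 ->; rewrite pmulr_rlt0.
  have [y0|y0|y0] := ltgtP (y i2 0) 0; first by apply: Or32; split=> //; exact/neg.
    by apply: Or31; split=> //; exact/pos.
  have [z0|z0|z0] := ltgtP (z i2 0) 0; last exact: Or33.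
    by move: z0 => /neg; rewrite y0 ltxx.
  by move: z0 => /pos; rewrite y0 ltxx.
move=> S.
have [a a0 E] : exists2 a, 0 < a & z i2 0 = a * y i2 0.
  case: S => [[y0 z0]|[y0 z0]|[y0 z0]].
  - by exists (z i2 0 / y i2 0); rewrite ?divr_gt0// divfK// gt_eqF.
  - exists (z i2 0 / y i2 0); last by rewrite divfK// lt_eqF.
    by rewrite -mulrNN -invrN divr_gt0// oppr_gt0.
  - by exists 1; rewrite ?ltr01// y0 z0 mulr0.
apply: (reach_trans HG (z := a *: y)); apply: conf_gen_reach.
  by apply: reach_mono (reach_Rpos y a0); exact: subsetUl.
have -> : z = a *: y + (z - a *: y) by rewrite addrC subrK.
apply: reach_mono (reach_P _ _); first exact: subsetUr.
by rewrite !mxE E subrr.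
Qed.

Lemma orbits_axis y z :
  reach (conf_gen (Rpos_grp R `|` SO2_grp R `|` L_grp R)) y z <->
  ((y i0 0 = 0 /\ y i1 0 = 0) <-> (z i0 0 = 0 /\ z i1 0 = 0)).
Proof.
have HG := conf_gen_subgroup SO2_sub_Conf.
pose N w := w i0 0 ^+ 2 + w i1 0 ^+ 2.
have N0 w : N w = 0 <-> (w i0 0 = 0 /\ w i1 0 = 0).
  split=> [/eqP|[w0 w1]]; last by rewrite /N w0 w1 expr0n addr0.
  by rewrite paddr_eq0 ?sqr_ge0// !sqrf_eq0 => /andP[/eqP ? /eqP ?].
have Nge w : 0 <= N w by rewrite addr_ge0 ?sqr_ge0.
have NRot t w : N (Rot t *m w) = N w.
  have [h0 h1 _] := Rot_mul t w; rewrite /N h0 h1.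
  transitivity ((cos t ^+ 2 + sin t ^+ 2) * (w i0 0 ^+ 2 + w i1 0 ^+ 2)).
    by ring.
  by rewrite cos2Dsin2 mul1r.
have NL a w : N (a *: w) = a ^+ 2 * N w by rewrite /N !mxE; ring.
split.
  move=> r; suff : N z = 0 <-> N y = 0 by rewrite !N0 => E; split=> ?; exact/E.
  apply: (conf_gen_invariant (J := fun w => N w = 0) SO2_sub_Conf _ r).
  move=> g w [[[a a0 ->]|[t ->]]|[a ->]].
  - rewrite cact_dil NL; split=> [/eqP|->]; last by rewrite mulr0.
    by rewrite mulf_eq0 sqrf_eq0 gt_eqF//= => /eqP.
  - by rewrite cact_lin NRot.
  - rewrite cact_trans (_ : N (w + _) = N w)//.
    by rewrite /N !mxE !inord_i /=; ring.
move=> S; have {}S : N y = 0 <-> N z = 0 by rewrite !N0.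
have shift u v : u i0 0 = v i0 0 -> u i1 0 = v i1 0 ->
    reach (conf_gen (Rpos_grp R `|` SO2_grp R `|` L_grp R)) u v.
  move=> h0 h1; have -> : v = u + (v - u) by rewrite addrC subrK.
  apply: conf_gen_reach; apply: reach_mono (reach_L _ _ _); first exact: subsetUr.
    by rewrite !mxE h0 subrr.
  by rewrite !mxE h1 subrr.
have [/eqP Ny|Ny] := boolP (N y == 0).
  have Nz : N z = 0 by apply/S.
  move: Ny Nz => /N0 [y0 y1] /N0 [z0 z1].
  by apply: shift; rewrite ?y0 ?y1 ?z0 ?z1.
have Nz : N z != 0 by apply: contra Ny => /eqP /S ->.
have Ny0 : 0 < N y by rewrite lt_neqAle eq_sym Ny Nge.
have Nz0 : 0 < N z by rewrite lt_neqAle eq_sym Nz Nge.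
pose a := Num.sqrt (N z / N y).
have a0 : 0 < a by rewrite sqrtr_gt0 divr_gt0.
pose u := a *: y.
have Nu : N u = N z by rewrite NL /a sqr_sqrtr ?divfK// divr_ge0.
(* the angle from the projection of [u] to that of [z] *)
have [|t [ct st]] := @exists_angle R ((u i0 0 * z i0 0 + u i1 0 * z i1 0) / N z)
  ((u i1 0 * z i0 0 - u i0 0 * z i1 0) / N z).
  have E : (u i0 0 * z i0 0 + u i1 0 * z i1 0) ^+ 2 +
      (u i1 0 * z i0 0 - u i0 0 * z i1 0) ^+ 2 = N u * N z by rewrite /N; ring.
  by rewrite !expr_div_n -mulrDl E Nu expr2 divff// mulf_neq0.
apply: (reach_trans HG (z := u)).
  apply: conf_gen_reach; apply: reach_mono (reach_Rpos y a0).
  by move=> g Hg; left; left.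
apply: (reach_trans HG (z := Rot t *m u)).
  apply: conf_gen_reach; exists (cmk 1 (Rot t) 0); last by rewrite cact_lin.
  by left; right; exists t.
have [h0 h1 _] := Rot_mul t u.
apply: shift; rewrite ?h0 ?h1 ct st.
  transitivity (N u * z i0 0 / N z); first by rewrite /N; field.
  by rewrite Nu mulrAC divff// mul1r.
transitivity (N u * z i1 0 / N z); first by rewrite /N; field.
by rewrite Nu mulrAC divff// mul1r.
Qed.

(** Orthogonal maps send [u] and [v] to the last axis; composing with a
    reflection that fixes this axis corrects the determinant if needed. *)
Lemma SO3_transitive u v : sqnorm u = 1 -> sqnorm v = 1 ->
  exists M : 'M[R]_3, [/\ M *m M^T = 1%:M, \det M = 1 & M *m u = v].
Proof.
move=> u1 v1.
have e1 : sqnorm (e_ R i2) = 1 by rewrite /sqnorm dot3 !e_coord /=; ring.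
have [B BB Bu] := householder u1 e1; have [C CC Cv] := householder v1 e1.
have dB : \det B ^+ 2 = 1 by rewrite expr2 -{2}det_tr -det_mulmx BB det1.
have dC : \det C ^+ 2 = 1 by rewrite expr2 -{2}det_tr -det_mulmx CC det1.
pose s := \det B * \det C.
pose dv : 'rV[R]_3 := \row_i [:: s; 1; 1]`_i.
pose D := diag_mx dv.
have ss : s * s = 1 by rewrite /s mulrACA -!expr2 dB dC mulr1.
have DD : D *m D^T = 1%:M.
  rewrite tr_diag_mx mulmx_diag; apply/matrixP => i j; rewrite !mxE.
  by case: eqP => // _; rewrite !mulr1n; move: i; apply: ord3P; rewrite /= ?mulr1.
have De : D *m e_ R i2 = e_ R i2.
  by rewrite mul_diag_mx; apply: cV3P; rewrite !mxE /=; ring.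
exists (C^T *m (D *m B)); split.
- rewrite !trmx_mul trmxK !mulmxA -(mulmxA _ B) BB mulmx1 -(mulmxA _ D) DD mulmx1.
  exact: orthogonal_tr.
- rewrite !det_mulmx det_tr det_diag (bigD1 i0)//= (bigD1 i1)//= (bigD1 i2)//= big1.
    by rewrite !mxE /= !mulr1 -ss /s; ring.
  by apply: ord3P.
- by rewrite -!mulmxA Bu De -Cv mulmxA orthogonal_tr// mul1mx.
Qed.

Lemma orbits_origin y z : reach (conf_gen (Rpos_grp R `|` SO3_grp R)) y z <->
  (y = 0 <-> z = 0).
Proof.
have HG := conf_gen_subgroup SO3_sub_Conf; split.
  move=> r; suff : z = 0 <-> y = 0 by move=> E; split=> ?; exact/E.
  apply: (conf_gen_invariant (J := fun w => w = 0) SO3_sub_Conf _ r).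
  move=> g w [[a a0 ->]|[M [MM _ ->]]].
    rewrite cact_dil; split=> [/eqP|->]; last by rewrite scaler0.
    by rewrite scaler_eq0 gt_eqF//= => /eqP.
  rewrite cact_lin; split=> [Mw|->]; last by rewrite mulmx0.
  by rewrite -[w]mul1mx -(orthogonal_tr MM) -mulmxA Mw mulmx0.
move=> S; have [y0|y0] := eqVneq y 0.
  have -> : z = 0 by exact/S.
  by rewrite y0; exact: (reach_refl HG).
have z0 : z != 0 by apply: contra y0 => /eqP /S ->.
have sy := sqnorm_gt0 y0; have sz := sqnorm_gt0 z0.
pose a := (Num.sqrt (sqnorm y))^-1; pose b := Num.sqrt (sqnorm z).
have a0 : 0 < a by rewrite invr_gt0 sqrtr_gt0.
have b0 : 0 < b by rewrite sqrtr_gt0.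
have ay : sqnorm (a *: y) = 1.
  by rewrite sqnormZ /a exprVn sqr_sqrtr ?(ltW sy)// mulVf// gt_eqF.
have bz : sqnorm (b^-1 *: z) = 1.
  by rewrite sqnormZ /b exprVn sqr_sqrtr ?(ltW sz)// mulVf// gt_eqF.
have [M [MM dM Mu]] := SO3_transitive ay bz.
apply: (reach_trans HG (z := a *: y)).
  by apply: conf_gen_reach; apply: reach_mono (reach_Rpos y a0); exact: subsetUl.
apply: (reach_trans HG (z := b^-1 *: z)).
  by apply: conf_gen_reach; exists (cmk 1 M 0); [right; exists M|rewrite cact_lin].
rewrite -{2}[z](scalerK (a := b)) ?gt_eqF//.
rewrite scalerA mulrC -scalerA.
by apply: conf_gen_reach; apply: reach_mono (reach_Rpos _ b0); exact: subsetUl.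
Qed.
End ModelOrbits.

(** * Points outside a proper subspace *)

Section Conclusion.
Variable R : realType.
Implicit Types (y z p : 'cV[R]_3) (C Q : 'M[R]_3).

(** The trace of an idempotent is its rank; when its image lies in a line,
    [(\tr Q) *: Q = Q] forces this trace to be 0 or 1. *)
Lemma image_off_line Q (a : 'cV[R]_3) : Q *m Q = Q -> \tr Q != 0 -> \tr Q != 1 ->
  exists w, forall r, Q *m w <> r *: a.
Proof.
move=> QQ t0 t1; apply: contrapT => H.
have lam w : {r | Q *m w = r *: a}.
  by apply/cid; apply: contrapT => nr; apply: H; exists w => r E; apply: nr; exists r.
pose r : 'rV[R]_3 := \row_j sval (lam (delta_mx j 0)).
have Qar : Q = a *m r.
  apply/matrixP => i j; rewrite mxE big_ord1 !mxE; case: (lam _) => l /= /matrixP /(_ i 0).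
  by rewrite -colE !mxE => ->; rewrite mulrC.
have trE : \tr Q = (r *m a) 0 0 by rewrite {1}Qar mxtrace_mulC /mxtrace big_ord1.
have : Q = \tr Q *: Q.
  rewrite -{1}QQ {1 2}Qar -mulmxA (mulmxA r) [r *m a]mx11_scalar -trE.
  by rewrite mul_scalar_mx -scalemxAr -Qar.
move=> /(congr1 mxtrace); rewrite mxtraceZ => /eqP.
rewrite eq_sym -subr_eq0 -{3}[\tr Q]mul1r -mulrBl mulf_eq0 subr_eq0.
by rewrite (negbTE t0) (negbTE t1).
Qed.

(** When the image of [Q] has dimension at least two, the complement of
    [p + ker Q] is connected by paths made of two segments. *)
Lemma reach_outside (G : set (conf_space R)) p Q : conf_subgroup G ->
  Q *m Q = Q -> \tr Q != 0 -> \tr Q != 1 ->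
  (forall y z, (forall t : R, 0 <= t <= 1 ->
     Q *m (y + t *: (z - y) - p) != 0) -> reach G y z) ->
  forall y z, Q *m (y - p) != 0 -> Q *m (z - p) != 0 -> reach G y z.
Proof.
move=> GS QQ t0 t1 seg.
have step y z : Q *m (y - p) != 0 ->
    (forall r, Q *m (z - p) <> r *: (Q *m (y - p))) -> reach G y z.
  move=> y0 zy; apply: seg => t t01; apply/eqP.
  have -> : y + t *: (z - y) - p = (1 - t) *: (y - p) + t *: (z - p).
    by apply/matrixP => i j; rewrite !mxE; ring.
  rewrite mulmxDr -!scalemxAr => E.
  have tn0 : t != 0.
    apply: contra y0 => /eqP tE; move: E.
    by rewrite tE subr0 scale1r scale0r addr0 => ->.
  apply: (zy (- (t^-1 * (1 - t)))); rewrite scaleNr -scalerA; apply/eqP.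
  by rewrite -addr_eq0 addrC -[X in _ + X](scalerK tn0) -scalerDr E scaler0.
move=> y z y0 z0.
have [[r zE]|nz] :=
  pselect (exists r, Q *m (z - p) = r *: (Q *m (y - p))); last first.
  by apply: step => // r E; apply: nz; exists r.
have [w Hw] := image_off_line (Q *m (y - p)) QQ t0 t1.
have wE : Q *m (p + w - p) = Q *m w by rewrite [p + w]addrC addrK.
apply: (reach_trans GS (z := p + w)); first by apply: step => // s; rewrite wE.
apply: (reach_sym GS); apply: step => // s; rewrite wE zE scalerA; exact: Hw.
Qed.

Lemma e2_unit : sqnorm (e_ R i2) = 1.
Proof. by rewrite /sqnorm dot3 !e_coord /=; ring. Qed.

Definition frame C p := cmk 1 C (- (C *m p)).

Lemma frame_act C p y : cact (frame C p) y = C *m (y - p).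
Proof.
by rewrite /cact [cscale _]/= [clin _]/= [ctrans _]/= scale1r mulmxBr.
Qed.

Lemma last_coord C (n v : 'cV[R]_3) : C *m C^T = 1%:M -> C *m n = e_ R i2 ->
  (C *m v) i2 0 = dot n v.
Proof.
move=> CC Cn; have -> : (C *m v) i2 0 = dot (e_ R i2) (C *m v).
  by rewrite dot3 !e_coord /=; ring.
by rewrite dot_mul -Cn mulmxA orthogonal_tr// mul1mx.
Qed.

Lemma same_sign_avoid (a b t : R) : 0 <= t <= 1 -> same_sign a b -> a != 0 ->
  (1 - t) * a + t * b != 0.
Proof.
move=> /andP[t0 t1] [[a0 b0]|[a0 b0]|[-> _]]; last by rewrite eqxx.
  move=> _; rewrite gt_eqF//; have [->|tn] := eqVneq t 0.
    by rewrite subr0 mul1r mul0r addr0.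
  apply: ltr_wpDl; first by rewrite mulr_ge0 ?subr_ge0 ?(ltW a0).
  by rewrite mulr_gt0// lt0r tn.
move=> _; rewrite lt_eqF//; have [->|tn] := eqVneq t 0.
  by rewrite subr0 mul1r mul0r addr0.
apply: ltr_wnDl; first by rewrite mulr_ge0_le0 ?subr_ge0 ?(ltW a0).
by rewrite pmulr_rlt0// lt0r tn.
Qed.

End Conclusion.

(** * The classification *)

Theorem theorem3p2 (R : realType) (d : nat) (G : set (conf_space R))
    (A : set (chart (conf_space R) d))
    (G_lie : connected_lie_subgroup G A)
    (G_cohom0 : has_cohomogeneity G A 0) :
  [\/ same_orbits_up_to_conj G (trans_grp R),
      same_orbits_up_to_conj G (conf_gen (Rpos_grp R `|` P_grp R)),
      same_orbits_up_to_conj G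
        (conf_gen (Rpos_grp R `|` SO2_grp R `|` L_grp R)) |
      same_orbits_up_to_conj G (conf_gen (Rpos_grp R `|` SO3_grp R))].
Proof.
have GS : conf_subgroup G by case: G_lie => -[].
have GI : immersed_submanifold G A by case: G_lie => -[].
have [c0 [u0 [Ac0 cu0 c0u0]]] : exists c u, [/\ A c, chart_dom c u & c u = cone R].
  by apply: (immersed_chart_at GI); case: GS.
have GC : G `<=` @Conf R by case: GS.
have GV g : G g -> G (cinv g) by case: GS => _ _ _; apply.
have pos g : G g -> 0 < cscale g.
  apply: (lie_sign G_lie (@cscale_continuous R)); last exact: ltr01.
  by move=> h Gh; case: GS => /(_ h Gh) [].
have [x fx] := open_orbit_point G_lie Ac0 cu0 c0u0 G_cohom0.
have [p [Q Qcases [flat seg act]]] := orbit_structure GS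
  (@tangent_lin _ _ c0 u0) (tangent_Ad G_lie Ac0 cu0 c0u0)
  (orbit_const G_lie Ac0 cu0 c0u0) (orbit_tangent_const G_lie Ac0 cu0 c0u0)
  (orbit_open G_lie Ac0 cu0 c0u0)
  (translation_part GV GC (tangent_Ad G_lie Ac0 cu0 c0u0)) fx pos.
have Qstable g y : G g -> Q *m (y - p) = 0 <-> Q *m (cact g y - p) = 0.
  move=> Gg; rewrite act//; split=> [->|/eqP]; first by rewrite mulmx0 scaler0.
  rewrite scaler_eq0 gt_eqF ?pos//= => /eqP E.
  by rewrite -[LHS]mul1mx -(conf_orth' (GC g Gg)) -mulmxA E mulmx0.
(* when the image of [Q] is not a line, [p + ker Q] and its complement are the
   only orbits *)
have dichotomy : forall y z, \tr Q = 2%:R \/ \tr Q = 3%:R -> Q *m Q = Q ->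
    reach G y z <-> (Q *m (y - p) = 0 <-> Q *m (z - p) = 0).
  move=> y z trQ QQ; split=> [[g Gg <-]|S]; first exact: Qstable.
  have [y0|y0] := eqVneq (Q *m (y - p)) 0.
    by apply: flat => //; exact/S.
  have z0 : Q *m (z - p) != 0 by apply: contra y0 => /eqP /S ->.
  by apply: (reach_outside GS QQ _ _ seg) => //; case: trQ => ->; rewrite ?pnatr_eq0 ?pnatr_eq1.
case: Qcases => [Q0|[n n1 QE]|[l l1 QE]|Q1].
- apply: Or41; apply: (@same_orbits_of_reach R (cone R)); first exact: Conf_cone.
  move=> y z; split=> _; first exact: reach_trans_grp.
  by apply: flat; rewrite Q0 mul0mx.
- apply: Or42.
  (* [Q] projects onto a line: the coordinate along [n] decides *)
  have [C CC Cn] := householder n1 (e2_unit R).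
  apply: (@same_orbits_of_reach R (frame C p)); first exact: Conf_lin.
  have coord y : cact (frame C p) y i2 0 = dot n (y - p).
    by rewrite frame_act (last_coord _ CC Cn).
  move=> y z; rewrite orbits_halfspace !coord.
  have Qdot (w : 'cV[R]_3) : Q *m w = 0 <-> dot n w = 0.
    rewrite QE mul_line; split=> [/(congr1 (dot n))|->]; last by rewrite scale0r.
    have d0 : dot n 0 = 0 by rewrite /dot mulmx0 mxE.
    by rewrite dotZr -/(sqnorm n) n1 mulr1 d0.
  have nz (w : 'cV[R]_3) : Q *m w != 0 <-> dot n w != 0.
    by split; apply: contra => /eqP /Qdot ->.
  split=> [[g Gg gz]|S].
    (* [a] is 1 or -1 below, one for each side of the plane *)
    have sgn (a : R) : a * dot n (y - p) > 0 -> a * dot n (z - p) > 0.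
      move=> ay; have ny : dot n (y - p) != 0.
        by apply: contraTneq ay => ->; rewrite mulr0 ltxx.
      rewrite -gz; move: g Gg {gz}.
      pose phi g := a * dot n (cact g y - p).
      apply: (@lie_sign _ _ _ _ G_lie phi); last by rewrite /phi cact_one.
        move=> g; apply: cvgM; first exact: cvg_cst.
        have -> : (fun g => dot n (cact g y - p)) =
            (fun g => (n^T *m cact g y) 0 0 - dot n p).
          by apply/funext => k; rewrite dotBr.
        rewrite dotBr.
        apply: cvgB; last exact: cvg_cst.
        have di : differentiable (id : conf_space R -> conf_space R) g.
          exact: ex_diff.
        exact: differentiable_continuous (differentiable_mul_cact n^T y 0 di).
      move=> g Gg; rewrite /phi mulf_eq0 negb_or; apply/andP; split.
        by apply: contraTneq ay => ->; rewrite mul0r ltxx.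
      by apply/nz/eqP => /(Qstable g y Gg) /Qdot /eqP; exact/negP.
    have [y0|y0|y0] := ltgtP (dot n (y - p)) 0.
    - apply: Or32; split=> //; have := sgn (-1); rewrite !mulN1r !oppr_gt0; exact.
    - by apply: Or31; split=> //; have := sgn 1; rewrite !mul1r; exact.
    - by apply: Or33; split=> //; apply/Qdot; rewrite -gz; apply/(Qstable g y Gg)/Qdot.
  have [y0|y0] := eqVneq (dot n (y - p)) 0.
    apply: flat; apply/Qdot => //.
    by case: S => [[]|[]|[]]; rewrite y0 ?ltxx.
  apply: seg => t t01.
  have -> : y + t *: (z - y) - p = (1 - t) *: (y - p) + t *: (z - p).
    by apply/matrixP => i j; rewrite !mxE; ring.
  by apply/nz; rewrite dotDr !dotZr; exact: same_sign_avoid.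
- apply: Or43.
  have [C CC Cl] := householder l1 (e2_unit R).
  apply: (@same_orbits_of_reach R (frame C p)); first exact: Conf_lin.
  have axis (w : 'cV[R]_3) : Q *m w = 0 <-> ((C *m w) i0 0 = 0 /\ (C *m w) i1 0 = 0).
    rewrite QE mulmxBl mul1mx (mul_line l w); split.
      move=> /eqP; rewrite subr_eq0 => /eqP ->.
      by rewrite -scalemxAr Cl ![(_ *: e_ R i2) _ _]mxE !e_coord /= mulr0.
    move=> [w0 w1]; have Cw : C *m w = dot l w *: e_ R i2.
      apply: cV3P; rewrite ?w0 ?w1 ?(last_coord w CC Cl) [RHS]mxE e_coord /=.
      - by rewrite mulr0.
      - by rewrite mulr0.
      - by rewrite mulr1.
    have wE : w = dot l w *: l.
      rewrite -{1}[w]mul1mx -(orthogonal_tr CC) -mulmxA Cw -Cl -scalemxAr mulmxA.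
      by rewrite (orthogonal_tr CC) mul1mx.
    by rewrite {1}wE subrr.
  move=> y z; rewrite orbits_axis !frame_act -!axis; apply: dichotomy.
    left; rewrite QE linearB /= mxtrace1 mxtrace_mulC dot_tr mxtrace_scalar.
    by rewrite -/(sqnorm l) l1; ring.
  by case: (orthproj_compl (orthproj_line l1)); rewrite QE.
- apply: Or44.
  apply: (@same_orbits_of_reach R (cmk 1 1%:M (- p))); first exact: Conf_trans.
  have Q1E (w : 'cV[R]_3) : w = 0 <-> Q *m w = 0 by rewrite Q1 mul1mx.
  move=> y z; rewrite orbits_origin !cact_trans (Q1E (y - p)) (Q1E (z - p)).
  apply: dichotomy.
    by right; rewrite Q1 mxtrace1.
  by rewrite Q1 mul1mx.
Qed.
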